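(* For all $m,s\in\mathbb N$, the $\kappa$-module $\mathrm{Hom}_{\mathcal B}(\mathsf m,\mathsf s)$ has a $\kappa$-basis given by $\mathbb B_{m,s}/\sim$, the set of equivalence classes of $(m,s)$-Brauer diagrams (each class being identified with the morphism represented by any of its elements).
   Context: $\kappa$ is a commutative ring with $1$ in which $2$ is invertible; $\mathbb N=\{0,1,2,\dots\}$. All monoidal categories are strict. The Brauer category $\mathcal B$ is the $\kappa$-linear monoidal category generated by one object $\mathsf 1$ (its objects are $\mathsf m:=\mathsf 1^{\otimes m}$, $m\in\mathbb N$, and $\mathsf 0$ is the unit object) and three morphisms $U:\mathsf 0\to\mathsf 2$, $A:\mathsf 2\to\mathsf 0$, $S:\mathsf 2\to\mathsf 2$ subject to the relations $S\circ S=1_{\mathsf 2}$; $(S\otimes 1_{\mathsf 1})\circ(1_{\mathsf 1}\otimes S)\circ(S\otimes 1_{\mathsf 1})=(1_{\mathsf 1}\otimes S)\circ(S\otimes 1_{\mathsf 1})\circ(1_{\mathsf 1}\otimes S)$; $(1_{\mathsf 1}\otimes A)\circ(U\otimes 1_{\mathsf 1})=1_{\mathsf 1}=(A\otimes 1_{\mathsf 1})\circ(1_{\mathsf 1}\otimes U)$; $U=S\circ U$; $A=A\circ S$; $(A\otimes 1_{\mathsf 1})\circ(1_{\mathsf 1}\otimes S)=(1_{\mathsf 1}\otimes A)\circ(S\otimes 1_{\mathsf 1})$; $(S\otimes 1_{\mathsf 1})\circ(1_{\mathsf 1}\otimes U)=(1_{\mathsf 1}\otimes S)\circ(U\otimes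 1_{\mathsf 1})$. Draw $U$ as a cup, $A$ as a cap, $S$ as a crossing, $1_{\mathsf 1}$ as a vertical line; $g\circ h$ is drawn by stacking $g$ on top of $h$, and $\otimes$ is horizontal juxtaposition. An $(m,s)$-Brauer diagram is a string diagram obtained from $U,A,S,1_{\mathsf 1}$ by tensor products and compositions, with $m$ endpoints on the bottom row and $s$ endpoints on the top row; it represents a morphism $\mathsf m\to\mathsf s$. $\mathbb B_{m,s}$ is the set of all of them. Number the bottom endpoints $1,\dots,m$ and the top endpoints $m+1,\dots,m+s$ from left to right. In a diagram each endpoint is joined by a strand to exactly one other endpoint, which gives a partition of $\{1,\dots,m+s\}$ into pairs; closed loops are called bubbles. Two diagrams $d,d'\in\mathbb B_{m,s}$ are equivalent, $d\sim d'$, if they have the same number of bubbles and give the same partition of $\{1,\dots,m+s\}$ into pairs. Equivalent diagrams represent the same morphism of $\mathcal B$. *)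

(* Defs.v *)
From HB Require Import structures.
From mathcomp Require Import all_boot all_algebra.
From mathcomp Require Import boolp.

Set Implicit Arguments.
Unset Strict Implicit.
Unset Printing Implicit Defensive.

Import GRing.Theory.

Local Open Scope quotient_scope.

(** Objects are natural numbers, with [m] standing for the [m]-th tensor power
    of the generating object.  [term K m s] consists of the formal morphisms
    from [m] to [s] built with the operations of a [K]-linear monoidal
    category; morphisms are the classes of terms modulo [term_eq]. *)
Inductive term (K : comPzRingType) : nat -> nat -> Type :=
| tId m : term K m m
| tComp m n s of term K n s & term K m n : term K m s
| tTens m s m' s' of term K m s & term K m' s' : term K (m + m') (s + s')
| tU : term K 0 2
| tA : term K 2 0
| tS : term K 2 2
| tZero m s : term K m s
| tOpp m s of term K m s : term K m s
| tAdd m s of term K m s & term K m s : term K m s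
| tScale m s of K & term K m s : term K m s.

Arguments tId {K} m.
Arguments tU {K}.
Arguments tA {K}.
Arguments tS {K}.
Arguments tZero {K} m s.

Declare Scope term_scope.
Delimit Scope term_scope with term.
Bind Scope term_scope with term.

Notation "g \oc f" := (tComp g f) (at level 40, left associativity) : term_scope.
Notation "f \ot g" := (tTens f g) (at level 38, left associativity) : term_scope.

(** The monoidal structure is strict, but [m + 0] and [m], or [(m + n) + p] and
    [m + (n + p)], are only propositionally equal. *)
Definition cast_term (K : comPzRingType) m m' s s'
    (em : m = m') (es : s = s') (f : term K m s) : term K m' s' :=
  ecast x (term K x s') em (ecast y (term K m y) es f).

Inductive term_eq (K : comPzRingType) :
    forall m s : nat, term K m s -> term K m s -> Prop :=
| te_refl m s (f : term K m s) : term_eq f f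
| te_sym m s (f g : term K m s) : term_eq f g -> term_eq g f
| te_trans m s (f g h : term K m s) :
    term_eq f g -> term_eq g h -> term_eq f h
| te_comp m n s (g g' : term K n s) (f f' : term K m n) :
    term_eq g g' -> term_eq f f' -> term_eq (g \oc f) (g' \oc f')
| te_tens m s m' s' (f f' : term K m s) (g g' : term K m' s') :
    term_eq f f' -> term_eq g g' -> term_eq (f \ot g) (f' \ot g')
| te_opp m s (f f' : term K m s) : term_eq f f' -> term_eq (tOpp f) (tOpp f')
| te_add m s (f f' g g' : term K m s) :
    term_eq f f' -> term_eq g g' -> term_eq (tAdd f g) (tAdd f' g')
| te_scale m s (a : K) (f f' : term K m s) :
    term_eq f f' -> term_eq (tScale a f) (tScale a f')
| te_id_comp m s (f : term K m s) : term_eq (tId s \oc f) f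
| te_comp_id m s (f : term K m s) : term_eq (f \oc tId m) f
| te_compA m n p s (h : term K p s) (g : term K n p) (f : term K m n) :
    term_eq (h \oc (g \oc f)) ((h \oc g) \oc f)
| te_tens_id m n : term_eq (tId m \ot tId n) (tId (m + n))
| te_interchange m n s m' n' s' (g : term K n s) (f : term K m n)
    (g' : term K n' s') (f' : term K m' n') :
    term_eq ((g \oc f) \ot (g' \oc f')) ((g \ot g') \oc (f \ot f'))
| te_unit_tens m s (f : term K m s) : term_eq (tId 0 \ot f) f
| te_tens_unit m s (f : term K m s) :
    term_eq (cast_term (addn0 m) (addn0 s) (f \ot tId 0)) f
| te_tensA m s m' s' m'' s''
    (f : term K m s) (g : term K m' s') (h : term K m'' s'') :
    term_eq (cast_term (addnA m m' m'') (addnA s s' s'') (f \ot (g \ot h)))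
            ((f \ot g) \ot h)
| te_addA m s (f g h : term K m s) :
    term_eq (tAdd f (tAdd g h)) (tAdd (tAdd f g) h)
| te_addC m s (f g : term K m s) : term_eq (tAdd f g) (tAdd g f)
| te_add0 m s (f : term K m s) : term_eq (tAdd (tZero m s) f) f
| te_addN m s (f : term K m s) : term_eq (tAdd (tOpp f) f) (tZero m s)
| te_scaleA m s (a b : K) (f : term K m s) :
    term_eq (tScale a (tScale b f)) (tScale (a * b)%R f)
| te_scale1 m s (f : term K m s) : term_eq (tScale 1%R f) f
| te_scaleDr m s (a : K) (f g : term K m s) :
    term_eq (tScale a (tAdd f g)) (tAdd (tScale a f) (tScale a g))
| te_scaleDl m s (a b : K) (f : term K m s) :
    term_eq (tScale (a + b)%R f) (tAdd (tScale a f) (tScale b f))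
| te_compDl m n s (g g' : term K n s) (f : term K m n) :
    term_eq (tAdd g g' \oc f) (tAdd (g \oc f) (g' \oc f))
| te_compDr m n s (g : term K n s) (f f' : term K m n) :
    term_eq (g \oc tAdd f f') (tAdd (g \oc f) (g \oc f'))
| te_compZl m n s (a : K) (g : term K n s) (f : term K m n) :
    term_eq (tScale a g \oc f) (tScale a (g \oc f))
| te_compZr m n s (a : K) (g : term K n s) (f : term K m n) :
    term_eq (g \oc tScale a f) (tScale a (g \oc f))
| te_tensDl m s m' s' (f f' : term K m s) (g : term K m' s') :
    term_eq (tAdd f f' \ot g) (tAdd (f \ot g) (f' \ot g))
| te_tensDr m s m' s' (f : term K m s) (g g' : term K m' s') :
    term_eq (f \ot tAdd g g') (tAdd (f \ot g) (f \ot g'))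
| te_tensZl m s m' s' (a : K) (f : term K m s) (g : term K m' s') :
    term_eq (tScale a f \ot g) (tScale a (f \ot g))
| te_tensZr m s m' s' (a : K) (f : term K m s) (g : term K m' s') :
    term_eq (f \ot tScale a g) (tScale a (f \ot g))
| te_SS : term_eq (tS \oc tS) (tId 2)
| te_braid : @term_eq K 3 3
    ((tS \ot tId 1) \oc (tId 1 \ot tS) \oc (tS \ot tId 1))
    ((tId 1 \ot tS) \oc (tS \ot tId 1) \oc (tId 1 \ot tS))
| te_zigzagl : @term_eq K 1 1 ((tId 1 \ot tA) \oc (tU \ot tId 1)) (tId 1)
| te_zigzagr : @term_eq K 1 1 (tId 1) ((tA \ot tId 1) \oc (tId 1 \ot tU))
| te_SU : term_eq tU (tS \oc tU)
| te_AS : term_eq tA (tA \oc tS)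
| te_slideA : @term_eq K 3 1
    ((tA \ot tId 1) \oc (tId 1 \ot tS)) ((tId 1 \ot tA) \oc (tS \ot tId 1))
| te_slideU : @term_eq K 1 3
    ((tS \ot tId 1) \oc (tId 1 \ot tU)) ((tId 1 \ot tS) \oc (tU \ot tId 1)).

HB.instance Definition _ (K : comPzRingType) m s := gen_eqMixin (term K m s).
HB.instance Definition _ (K : comPzRingType) m s := gen_choiceMixin (term K m s).

Section BrauerHom.
Variables (K : comPzRingType) (m s : nat).
Implicit Types f g h : term K m s.

Definition term_eqb f g : bool := `[< term_eq f g >].

Lemma term_eqb_equiv : equiv_class_of term_eqb.
Proof.
split=> [f|f g|g f h].
- by apply/asboolP; exact: te_refl.
- by apply/asboolP/asboolP; exact: te_sym.
- by move=> /asboolP fg /asboolP gh; apply/asboolP; exact: te_trans fg gh.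
Qed.

Canonical term_eqb_rel := EquivRelPack term_eqb_equiv.

Definition brauer_hom : Type := {eq_quot term_eqb_rel}.

HB.instance Definition _ := Choice.on brauer_hom.
HB.instance Definition _ := Quotient.on brauer_hom.
HB.instance Definition _ := EqQuotient.on brauer_hom.

Definition hom_zero : brauer_hom := \pi_brauer_hom (tZero m s).
Definition hom_opp (x : brauer_hom) : brauer_hom :=
  \pi_brauer_hom (tOpp (repr x)).
Definition hom_add (x y : brauer_hom) : brauer_hom :=
  \pi_brauer_hom (tAdd (repr x) (repr y)).
Definition hom_scale (a : K) (x : brauer_hom) : brauer_hom :=
  \pi_brauer_hom (tScale a (repr x)).

Lemma pi_homP f g : (\pi_brauer_hom f = \pi_brauer_hom g) <-> term_eq f g.
Proof.
split=> [/eqmodP /asboolP //|fg].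
by apply/eqmodP/asboolP.
Qed.

Lemma repr_pi f : term_eq (repr (\pi_brauer_hom f)) f.
Proof. by apply/pi_homP; rewrite reprK. Qed.

Lemma hom_oppE f : hom_opp (\pi_brauer_hom f) = \pi_brauer_hom (tOpp f).
Proof. by apply/pi_homP/te_opp/repr_pi. Qed.

Lemma hom_addE f g :
  hom_add (\pi_brauer_hom f) (\pi_brauer_hom g) = \pi_brauer_hom (tAdd f g).
Proof. by apply/pi_homP/te_add; exact: repr_pi. Qed.

Lemma hom_scaleE a f :
  hom_scale a (\pi_brauer_hom f) = \pi_brauer_hom (tScale a f).
Proof. by apply/pi_homP/te_scale/repr_pi. Qed.

Lemma hom_addA : associative hom_add.
Proof.
elim/quotW=> f; elim/quotW=> g; elim/quotW=> h.
by rewrite (hom_addE g h) (hom_addE f g) !hom_addE; apply/pi_homP; exact: te_addA.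
Qed.

Lemma hom_addC : commutative hom_add.
Proof.
by elim/quotW=> f; elim/quotW=> g; rewrite !hom_addE; apply/pi_homP; exact: te_addC.
Qed.

Lemma hom_add0 : left_id hom_zero hom_add.
Proof. by elim/quotW=> f; rewrite hom_addE; apply/pi_homP/te_add0. Qed.

Lemma hom_addN : left_inverse hom_zero hom_opp hom_add.
Proof.
by elim/quotW=> f; rewrite hom_oppE hom_addE; apply/pi_homP; exact: te_addN.
Qed.

HB.instance Definition _ :=
  GRing.isZmodule.Build brauer_hom hom_addA hom_addC hom_add0 hom_addN.

Lemma hom_scaleA a b (x : brauer_hom) :
  hom_scale a (hom_scale b x) = hom_scale (a * b)%R x.
Proof.
by elim/quotW: x => f; rewrite (hom_scaleE b f) !hom_scaleE; apply/pi_homP; exact: te_scaleA.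
Qed.

Lemma hom_scale1 : left_id 1%R hom_scale.
Proof. by elim/quotW=> f; rewrite hom_scaleE; apply/pi_homP/te_scale1. Qed.

Lemma hom_scaleDr : right_distributive hom_scale +%R.
Proof.
move=> a; elim/quotW=> f; elim/quotW=> g.
rewrite /GRing.add /= (hom_addE f g) (hom_scaleE a f) (hom_scaleE a g).
by rewrite hom_scaleE hom_addE; apply/pi_homP; exact: te_scaleDr.
Qed.

Lemma hom_scaleDl (x : brauer_hom) : {morph hom_scale^~ x : a b / (a + b)%R}.
Proof.
elim/quotW: x => f a b; rewrite [RHS]/GRing.add /=.
rewrite (hom_scaleE _ f) (hom_scaleE a f) (hom_scaleE b f) hom_addE.
by apply/pi_homP; exact: te_scaleDl.
Qed.

HB.instance Definition _ :=
  GRing.Zmodule_isLmodule.Build K brauer_hom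
    hom_scaleA hom_scale1 hom_scaleDr hom_scaleDl.

End BrauerHom.

(** [dEmpty] is the empty tensor product of strands. *)
Inductive diagram : nat -> nat -> Type :=
| dEmpty : diagram 0 0
| dStrand : diagram 1 1
| dU : diagram 0 2
| dA : diagram 2 0
| dS : diagram 2 2
| dComp m n s of diagram n s & diagram m n : diagram m s
| dTens m s m' s' of diagram m s & diagram m' s' : diagram (m + m') (s + s').

Fixpoint diagram_term (K : comPzRingType) m s (d : diagram m s) : term K m s :=
  match d with
  | dEmpty => tId 0
  | dStrand => tId 1
  | dU => tU
  | dA => tA
  | dS => tS
  | dComp _ _ _ g f => tComp (diagram_term K g) (diagram_term K f)
  | dTens _ _ _ _ f g => tTens (diagram_term K f) (diagram_term K g)
  end.

Definition diagram_hom (K : comPzRingType) m s (d : diagram m s) :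
  brauer_hom K m s := \pi_(brauer_hom K m s) (diagram_term K d).

(** The drawing of a diagram as a graph: the vertices are the elementary arcs
    (one for a vertical line, a cup or a cap, two for a crossing), and two arcs
    are glued when they meet in the middle row of a composition.  The strands
    and the bubbles are the connected components. *)
Record drawing (m s : nat) := Drawing {
  arc : finType;
  bottom_arc : 'I_m -> arc;
  top_arc : 'I_s -> arc;
  glued : rel arc }.

Definition draw_empty : drawing 0 0 :=
  @Drawing 0 0 void (fun i => False_rect void (notF (ltn_ord i)))
    (fun i => False_rect void (notF (ltn_ord i))) (fun _ _ => false).

Definition draw_single m s : drawing m s :=
  @Drawing m s unit (fun=> tt) (fun=> tt) (fun _ _ => false).

(** One arc joins the bottom left to the top right endpoint, the other the
    bottom right to the top left endpoint. *)
Definition draw_crossing : drawing 2 2 :=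
  @Drawing 2 2 bool (fun i => i == ord0) (fun j => j != ord0)
    (fun _ _ => false).

Definition draw_comp m n s (D : drawing n s) (E : drawing m n) : drawing m s :=
  let meet (a : arc E) (b : arc D) :=
    [exists i : 'I_n, (top_arc E i == a) && (bottom_arc D i == b)] in
  @Drawing m s (arc E + arc D)%type
    (fun i => inl (bottom_arc E i)) (fun j => inr (top_arc D j))
    (fun x y => match x, y with
      | inl a, inl a' => glued a a'
      | inr b, inr b' => glued b b'
      | inl a, inr b | inr b, inl a => meet a b
      end).

Definition draw_tens m s m' s' (D : drawing m s) (E : drawing m' s') :
    drawing (m + m') (s + s') :=
  @Drawing (m + m') (s + s') (arc D + arc E)%type
    (fun i => match split i with
      | inl k => inl (bottom_arc D k) | inr k => inr (bottom_arc E k) end)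
    (fun j => match split j with
      | inl k => inl (top_arc D k) | inr k => inr (top_arc E k) end)
    (fun x y => match x, y with
      | inl a, inl a' => glued a a'
      | inr b, inr b' => glued b b'
      | _, _ => false
      end).

Fixpoint draw m s (d : diagram m s) : drawing m s :=
  match d with
  | dEmpty => draw_empty
  | dStrand => draw_single 1 1
  | dU => draw_single 0 2
  | dA => draw_single 2 0
  | dS => draw_crossing
  | dComp _ _ _ g f => draw_comp (draw g) (draw f)
  | dTens _ _ _ _ f g => draw_tens (draw f) (draw g)
  end.

(** The bottom endpoints come first, then the top ones. *)
Definition endpoint_arc m s (d : diagram m s) (i : 'I_(m + s)) : arc (draw d) :=
  match split i with
  | inl k => bottom_arc (draw d) k
  | inr k => top_arc (draw d) k
  end.

Definition joined m s (d : diagram m s) : rel 'I_(m + s) :=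
  fun i j => connect (@glued _ _ (draw d)) (endpoint_arc d i) (endpoint_arc d j).

Definition strand_partition m s (d : diagram m s) : {set {set 'I_(m + s)}} :=
  equivalence_partition (joined d) [set: 'I_(m + s)].

Definition bubbles m s (d : diagram m s) : nat :=
  n_comp (@glued _ _ (draw d))
    [pred x | [forall i, ~~ connect (@glued _ _ (draw d)) (endpoint_arc d i) x]].

Definition diagram_equiv m s : rel (diagram m s) :=
  fun d d' => (bubbles d == bubbles d')
    && (strand_partition d == strand_partition d').

HB.instance Definition _ m s := gen_eqMixin (diagram m s).
HB.instance Definition _ m s := gen_choiceMixin (diagram m s).

Lemma diagram_equiv_equiv m s : equiv_class_of (@diagram_equiv m s).
Proof.
split=> [d|d d'|d' d d''].
- by rewrite /diagram_equiv !eqxx.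
- by rewrite /diagram_equiv eq_sym [X in _ && X]eq_sym.
- by move=> /andP[/eqP b /eqP p] /andP[/eqP b' /eqP p'];
    rewrite /diagram_equiv b p b' p' !eqxx.
Qed.

Canonical diagram_equiv_rel m s := EquivRelPack (@diagram_equiv_equiv m s).

Definition diagram_class (m s : nat) : Type :=
  {eq_quot diagram_equiv_rel m s}.

HB.instance Definition _ m s := Choice.on (diagram_class m s).
HB.instance Definition _ m s := Quotient.on (diagram_class m s).
HB.instance Definition _ m s := EqQuotient.on (diagram_class m s).

Definition lin_independent (K : pzRingType) (V : lmodType K) (I : eqType)
    (b : I -> V) : Prop :=
  forall (r : seq I) (c : I -> K), uniq r ->
    (\sum_(i <- r) c i *: b i = 0)%R -> forall i, i \in r -> c i = 0%R.

Definition spanning (K : pzRingType) (V : lmodType K) (I : eqType)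
    (b : I -> V) : Prop :=
  forall v : V, exists (r : seq I) (c : I -> K), v = (\sum_(i <- r) c i *: b i)%R.

Definition is_basis (K : pzRingType) (V : lmodType K) (I : eqType)
    (b : I -> V) : Prop :=
  lin_independent b /\ spanning b.

(* Main.v *)
Require Import Defs.
From mathcomp Require Import all_boot all_algebra.
From mathcomp Require Import boolp zify.

Set Implicit Arguments.
Unset Strict Implicit.
Unset Printing Implicit Defensive.

(* Imported again so that [arc] denotes the arcs of a drawing, not [path.arc]. *)
Import Defs GRing.Theory.

(** Why the theorem holds.

    _An invariant of diagrams._  Colour every arc of a diagram with one of two
    colours so that glued arcs agree, and count the colourings with prescribed
    colours at the endpoints.  This gives a matrix [dmat d] of natural numbers,
    indexed by the colours at the bottom and at the top.  A colouring is a
    choice of colour for each connected component, so an entry is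
    [2 ^ bubbles d] if the prescribed colours agree along every strand, and 0
    otherwise ([dmat_count]).  Hence the matrix determines the number of bubbles
    and the partition of the endpoints, and conversely: two diagrams are
    equivalent exactly when their matrices agree ([diagram_equiv_dmat]).
    Stacking diagrams multiplies the matrices and juxtaposing them gives the
    Kronecker product; this is the functor to vector spaces that sends the
    generating object to a plane with an orthonormal basis.

    _Linear independence._  The entries must stay natural numbers, because
    distinct powers of 2 may coincide in [K].  So the matrices are not mapped to
    [K]: they are taken as the basis of free [K]-modules, which form a
    [K]-linear strict monoidal category in which all defining relations of the
    Brauer category hold ([ev_sound]).  There a diagram goes to the basis vector
    [dmat d], and the coefficients of a linear combination of pairwise
    inequivalent diagrams can be read off.

    _Equivalent diagrams are equal._  Bending the bottom endpoints up to the top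
    is injective ([unbend]), so it is enough to treat diagrams with no bottom
    endpoint.  Each of these equals a normal form ([normal_closed_diagram]): it
    is obtained from a power of the bubble by repeatedly adding a cup whose left
    leg is the leftmost strand and whose right leg is then carried past some
    number [i] of strands.  Normal forms are stable under a crossing, a cap or a
    cup at any place; the only delicate case is the crossing of the two leftmost
    strands, where the cups of two consecutive insertions are exchanged by
    pulling a strand through a cup ([swap0_insert], [cup_insert]).  Finally, a
    normal form can be reconstructed from its matrix ([nf_inj]), so diagrams
    with the same matrix have the same normal form ([dcls_of_dmat]).

    _Spanning_ is a formal induction on terms ([all_spanned]). *)

(** * Sums over words in two colours *)

Fixpoint bsum (n : nat) (F : seq bool -> nat) : nat :=
  if n is n'.+1
  then bsum n' (fun v => F (true :: v)) + bsum n' (fun v => F (false :: v))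
  else F [::].

Lemma eq_bsum n F G :
  (forall v, size v = n -> F v = G v) -> bsum n F = bsum n G.
Proof.
elim: n F G => [|n IHn] F G eqFG /=; first exact: eqFG.
by congr addn; apply: IHn => v sv; apply: eqFG; rewrite /= sv.
Qed.

Lemma bsum0 n : bsum n (fun=> 0) = 0.
Proof. by elim: n => //= n ->. Qed.

Lemma bsumD n F G : bsum n (fun v => F v + G v) = bsum n F + bsum n G.
Proof. by elim: n F G => //= n IHn F G; rewrite !IHn addnACA. Qed.

Lemma bsumMl n a F : bsum n (fun v => a * F v) = a * bsum n F.
Proof. by elim: n F => //= n IHn F; rewrite !IHn mulnDr. Qed.

Lemma bsumMr n a F : bsum n (fun v => F v * a) = bsum n F * a.
Proof. by elim: n F => //= n IHn F; rewrite !IHn mulnDl. Qed.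

Lemma bsum_exchange m n F :
  bsum m (fun u => bsum n (fun v => F u v)) =
  bsum n (fun v => bsum m (fun u => F u v)).
Proof. by elim: m F => //= m IHm F; rewrite !IHm bsumD. Qed.

Lemma bsum_cat m n F :
  bsum (m + n) F = bsum m (fun u => bsum n (fun v => F (u ++ v))).
Proof. by elim: m F => //= m IHm F; rewrite !IHm. Qed.

Lemma bsum_pick n u F : bsum n (fun v => ((size u == n) && (u == v)) * F v)
  = (size u == n) * F u.
Proof.
elim: n u F => [|n IHn] [|a u] F //=; first by rewrite bsum0.
have eqH b v : (size (a :: u) == n.+1) && (a :: u == b :: v)
  = (a == b) && ((size u == n) && (u == v)).
  by rewrite eqseq_cons eqSS; do !case: (_ == _).
under eq_bsum do rewrite eqH.
under [X in _ + X]eq_bsum do rewrite eqH.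
by case: a {eqH} => /=; rewrite bsum0 IHn ?addn0 ?eqSS.
Qed.

(** * Matrices over the natural numbers with entries indexed by colour words *)

(** The format is not part of the type, so that strict associativity and
    unitality of the tensor product are equalities without transport;
    [bmat_supp] recovers the format by asking for zeros elsewhere. *)
Definition bmat := seq bool -> seq bool -> nat.

Definition bmat_supp (m s : nat) (x : bmat) : Prop :=
  forall u w, (size u == m) && (size w == s) = false -> x u w = 0.

Definition bmat_id n : bmat := fun u w => (size u == n) && (u == w).

(** [x] is applied first: rows are indexed by sources. *)
Definition bmat_comp n (y x : bmat) : bmat :=
  fun u w => bsum n (fun v => x u v * y v w).

Definition bmat_tens m s (x y : bmat) : bmat :=
  fun u w => x (take m u) (take s w) * y (drop m u) (drop s w).

Definition bmat_U : bmat := fun u w =>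
  if u is [::] then if w is [:: a; b] then a == b else false else false.

Definition bmat_A : bmat := fun u w => bmat_U w u.

Definition bmat_S : bmat := fun u w =>
  if u is [:: a; b] then w == [:: b; a] else false.

Lemma bmat_ext m s x y : bmat_supp m s x -> bmat_supp m s y ->
  (forall u w, size u = m -> size w = s -> x u w = y u w) -> x = y.
Proof.
move=> sx sy exy; apply/funext => u; apply/funext => w.
have [/andP[/eqP su /eqP sw]|/negbTE nuw] := boolP ((size u == m) && (size w == s)).
  exact: exy.
by rewrite sx ?sy.
Qed.

Lemma supp_id n : bmat_supp n n (bmat_id n).
Proof.
move=> u w nuw; rewrite /bmat_id; case: eqP => //= su; case: eqP => // uw.
by rewrite -uw su eqxx in nuw.
Qed.

Lemma supp_comp m n s x y :
  bmat_supp m n x -> bmat_supp n s y -> bmat_supp m s (bmat_comp n y x).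
Proof.
move=> sx sy u w nuw; rewrite /bmat_comp -(bsum0 n); apply: eq_bsum => v sv.
move/negbT: nuw; rewrite negb_and => /orP[] /negbTE h.
  by rewrite sx // h.
by rewrite [y v w]sy ?muln0 // h andbF.
Qed.

Lemma take_drop_size (T : eqType) m n (u : seq T) :
  size (take m u) = m -> size (drop m u) = n -> size u = m + n.
Proof. by move=> e1 e2; rewrite -(cat_take_drop m u) size_cat e1 e2. Qed.

Lemma supp_tens m s m' s' x y : bmat_supp m s x -> bmat_supp m' s' y ->
  bmat_supp (m + m') (s + s') (bmat_tens m s x y).
Proof.
move=> sx sy u w nuw; rewrite /bmat_tens.
have [/andP[/eqP e1 /eqP e2]|/negbTE h] :=
  boolP ((size (take m u) == m) && (size (take s w) == s)); last by rewrite sx.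
have [/andP[/eqP e3 /eqP e4]|/negbTE h] :=
  boolP ((size (drop m u) == m') && (size (drop s w) == s')); last first.
  by rewrite [y _ _]sy // muln0.
by rewrite (take_drop_size e1 e3) (take_drop_size e2 e4) !eqxx in nuw.
Qed.

Lemma supp_U : bmat_supp 0 2 bmat_U.
Proof. by case=> [|a u] [|b [|c [|d w]]]. Qed.

Lemma supp_A : bmat_supp 2 0 bmat_A.
Proof. by move=> u w h; apply: supp_U; rewrite andbC. Qed.

Lemma supp_S : bmat_supp 2 2 bmat_S.
Proof.
by case=> [|a [|b [|c u]]] [|b' [|c' [|d w]]] //= _; rewrite /bmat_S /= !eqseq_cons ?andbF.
Qed.

(** A form of [supp_tens] that unifies with numerals such as 3, which are not
    syntactically sums. *)
Lemma supp_tens_eq m s m' s' M S x y : bmat_supp m s x -> bmat_supp m' s' y ->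
  M = m + m' -> S = s + s' -> bmat_supp M S (bmat_tens m s x y).
Proof. by move=> sx sy -> ->; exact: supp_tens. Qed.

Hint Resolve supp_id supp_comp supp_tens_eq supp_U supp_A supp_S : bsupp.

Lemma bmat_comp_id m s x : bmat_supp m s x -> bmat_comp m x (bmat_id m) = x.
Proof.
move=> sx; apply: (@bmat_ext m s); [by eauto with bsupp | by [] |] => u w su sw.
by rewrite /bmat_comp /bmat_id bsum_pick su eqxx mul1n.
Qed.

Lemma bmat_id_comp m s x : bmat_supp m s x -> bmat_comp s (bmat_id s) x = x.
Proof.
move=> sx; apply: (@bmat_ext m s); [by eauto with bsupp | by [] |] => u w su sw.
rewrite /bmat_comp /bmat_id.
transitivity (bsum s (fun v => ((size w == s) && (w == v)) * x u v)).
  apply: eq_bsum => v sv; rewrite mulnC sv sw eqxx /=.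
  by rewrite eq_sym.
by rewrite bsum_pick sw eqxx mul1n.
Qed.

Lemma bmat_compA n p h g f :
  bmat_comp p h (bmat_comp n g f) = bmat_comp n (bmat_comp p h g) f.
Proof.
apply/funext => u; apply/funext => w; rewrite /bmat_comp.
under eq_bsum do rewrite -bsumMr.
rewrite bsum_exchange; apply: eq_bsum => v _; rewrite -bsumMl.
by apply: eq_bsum => t _; rewrite mulnA.
Qed.

Lemma bmat_tens_id m n :
  bmat_tens m m (bmat_id m) (bmat_id n) = bmat_id (m + n).
Proof.
apply: (@bmat_ext (m + n) (m + n)); [by eauto with bsupp .. |] => u w su sw.
rewrite /bmat_tens /bmat_id size_takel ?su ?leq_addr // size_drop su addKn !eqxx /=.
rewrite mulnb; congr nat_of_bool.
by rewrite -eqseq_cat ?cat_take_drop // !size_takel ?su ?sw ?leq_addr.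
Qed.

Lemma bmat_interchange m n s m' n' s' g f g' f' :
  bmat_supp m n f -> bmat_supp n s g -> bmat_supp m' n' f' -> bmat_supp n' s' g' ->
  bmat_tens m s (bmat_comp n g f) (bmat_comp n' g' f') =
  bmat_comp (n + n') (bmat_tens n s g g') (bmat_tens m n f f').
Proof.
move=> sf sg sf' sg'; apply: (@bmat_ext (m + m') (s + s'));
  [by eauto with bsupp .. |] => u w su sw.
rewrite /bmat_tens /bmat_comp bsum_cat -bsumMr; apply: eq_bsum => v sv.
rewrite -bsumMl; apply: eq_bsum => v' sv'.
by rewrite -sv take_size_cat // drop_size_cat // mulnACA.
Qed.

Lemma bmat_unit_tens x : bmat_tens 0 0 (bmat_id 0) x = x.
Proof.
by apply/funext => u; apply/funext => w; rewrite /bmat_tens !take0 !drop0 mul1n.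
Qed.

Lemma bmat_tens_unit m s x : bmat_supp m s x -> bmat_tens m s x (bmat_id 0) = x.
Proof.
move=> sx; apply: (@bmat_ext m s) => //.
  by rewrite -{1}[m]addn0 -{1}[s]addn0; eauto with bsupp.
move=> u w su sw.
by rewrite /bmat_tens !take_oversize ?su ?sw // !drop_oversize ?su ?sw // muln1.
Qed.

Lemma bmat_tensA m s m' s' f g h :
  bmat_tens m s f (bmat_tens m' s' g h) =
  bmat_tens (m + m') (s + s') (bmat_tens m s f g) h.
Proof.
apply/funext => u; apply/funext => w; rewrite /bmat_tens.
rewrite !take_takel ?leq_addr // !drop_drop !take_drop.
by rewrite [m' + m]addnC [s' + s]addnC mulnA.
Qed.

(** * The defining relations for matrices *)

Fixpoint all_bits (n : nat) (P : pred (seq bool)) : bool :=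
  if n is n'.+1
  then all_bits n' (fun v => P (true :: v)) && all_bits n' (fun v => P (false :: v))
  else P [::].

Lemma all_bitsP n P v : all_bits n P -> size v = n -> P v.
Proof.
elim: n P v => [|n IHn] P [|[] v] //= /andP[Pt Pf] [sv].
  exact: (IHn _ _ Pt).
exact: (IHn _ _ Pf).
Qed.

(** Turns each defining relation of the Brauer category into a finite
    computation. *)
Lemma bmat_ext_dec m s x y : bmat_supp m s x -> bmat_supp m s y ->
  all_bits m (fun u => all_bits s (fun w => x u w == y u w)) -> x = y.
Proof.
move=> sx sy exy; apply: (bmat_ext sx sy) => u w su sw.
exact/eqP/(all_bitsP (all_bitsP exy su) sw).
Qed.

Section BrauerRelations.

Local Notation I := bmat_id.
Local Notation U := bmat_U.
Local Notation A := bmat_A.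
Local Notation X := bmat_S.

Lemma bmat_SS : bmat_comp 2 X X = I 2.
Proof.
apply: (@bmat_ext_dec 2 2); [by eauto with bsupp .. |].
by vm_compute.
Qed.

Lemma bmat_braid :
  bmat_comp 3 (bmat_comp 3 (bmat_tens 2 2 X (I 1)) (bmat_tens 1 1 (I 1) X))
     (bmat_tens 2 2 X (I 1)) =
  bmat_comp 3 (bmat_comp 3 (bmat_tens 1 1 (I 1) X) (bmat_tens 2 2 X (I 1)))
     (bmat_tens 1 1 (I 1) X).
Proof.
apply: (@bmat_ext_dec 3 3); [by eauto 8 with bsupp .. |].
by vm_compute.
Qed.

Lemma bmat_zigzagl : bmat_comp 3 (bmat_tens 1 1 (I 1) A) (bmat_tens 0 2 U (I 1)) = I 1.
Proof.
apply: (@bmat_ext_dec 1 1); [by eauto 8 with bsupp .. |].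
by vm_compute.
Qed.

Lemma bmat_zigzagr : bmat_comp 3 (bmat_tens 2 0 A (I 1)) (bmat_tens 1 1 (I 1) U) = I 1.
Proof.
apply: (@bmat_ext_dec 1 1); [by eauto 8 with bsupp .. |].
by vm_compute.
Qed.

Lemma bmat_SU : bmat_comp 2 X U = U.
Proof.
apply: (@bmat_ext_dec 0 2); [by eauto 8 with bsupp .. |].
by vm_compute.
Qed.

Lemma bmat_AS : bmat_comp 2 A X = A.
Proof.
apply: (@bmat_ext_dec 2 0); [by eauto 8 with bsupp .. |].
by vm_compute.
Qed.

Lemma bmat_slideA :
  bmat_comp 3 (bmat_tens 2 0 A (I 1)) (bmat_tens 1 1 (I 1) X) =
  bmat_comp 3 (bmat_tens 1 1 (I 1) A) (bmat_tens 2 2 X (I 1)).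
Proof.
apply: (@bmat_ext_dec 3 1); [by eauto 8 with bsupp .. |].
by vm_compute.
Qed.

Lemma bmat_slideU :
  bmat_comp 3 (bmat_tens 2 2 X (I 1)) (bmat_tens 1 1 (I 1) U) =
  bmat_comp 3 (bmat_tens 1 1 (I 1) X) (bmat_tens 0 2 U (I 1)).
Proof.
apply: (@bmat_ext_dec 1 3); [by eauto 8 with bsupp .. |].
by vm_compute.
Qed.

End BrauerRelations.

(** * The free K-linear category on matrices *)

Section Evaluation.
Variable K : comPzRingType.
Local Open Scope ring_scope.

(** A linear combination of matrices is encoded by the functional that sends a
    function [phi] on matrices to the corresponding combination of its values.
    So [ev f] is the image of [f] in the free module on matrices, seen inside
    its double dual; composition and tensor product are the bilinear extensions
    of those of matrices. *)
Fixpoint ev m s (f : term K m s) : (bmat -> K) -> K :=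
  match f with
  | tId n => fun phi => phi (bmat_id n)
  | tComp m n s g f => fun phi =>
      ev g (fun y => ev f (fun x => phi (bmat_comp n y x)))
  | tTens m s m' s' f g => fun phi =>
      ev f (fun x => ev g (fun y => phi (bmat_tens m s x y)))
  | tU => fun phi => phi bmat_U
  | tA => fun phi => phi bmat_A
  | tS => fun phi => phi bmat_S
  | tZero m s => fun=> 0
  | tOpp m s f => fun phi => - ev f phi
  | tAdd m s f g => fun phi => ev f phi + ev g phi
  | tScale m s a f => fun phi => a * ev f phi
  end.

(** Only matrices of the right format occur in the support of [ev f]; the unit
    laws and the interchange law for matrices depend on the format. *)
Lemma ev_ext m s (f : term K m s) phi psi :
  (forall x, bmat_supp m s x -> phi x = psi x) -> ev f phi = ev f psi.
Proof.
elim: f phi psi => {m s} /=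
  [n|m n s g IHg f IHf|m s m' s' f IHf g IHg|||
  |m s|m s f IHf|m s f IHf g IHg|m s a f IHf] phi psi eqp //;
  try by apply: eqp; eauto with bsupp.
- apply: IHg => y sy; apply: IHf => x sx; apply: eqp.
  exact: supp_comp.
- apply: IHf => x sx; apply: IHg => y sy; apply: eqp.
  exact: supp_tens.
- by rewrite (IHf _ _ eqp).
- by rewrite (IHf _ _ eqp) (IHg _ _ eqp).
- by rewrite (IHf _ _ eqp).
Qed.

Lemma ev_lin m s (f : term K m s) a phi psi :
  ev f (fun x => a * phi x + psi x) = a * ev f phi + ev f psi.
Proof.
elim: f phi psi => {m s} /=
  [n|m n s g IHg f IHf|m s m' s' f IHf g IHg|||
  |m s|m s f IHf|m s f IHf g IHg|m s b f IHf] phi psi //.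
- by rewrite -IHg; apply: ev_ext => y _; rewrite IHf.
- by rewrite -IHf; apply: ev_ext => y _; rewrite IHg.
- by rewrite mulr0 addr0.
- by rewrite IHf opprD mulrN.
- by rewrite IHf IHg mulrDr addrACA.
- by rewrite IHf mulrDr !mulrA [b * a]mulrC.
Qed.

Lemma ev_add m s (f : term K m s) phi psi :
  ev f (fun x => phi x + psi x) = ev f phi + ev f psi.
Proof.
by rewrite -[X in X + _]mul1r -ev_lin; apply: ev_ext => x _; rewrite mul1r.
Qed.

Lemma ev_zero m s (f : term K m s) : ev f (fun=> 0) = 0.
Proof.
apply: (addrI (ev f (fun=> 0))); rewrite -ev_add [RHS]addr0.
by apply: ev_ext => x _; rewrite addr0.
Qed.

Lemma ev_scale m s (f : term K m s) a phi :
  ev f (fun x => a * phi x) = a * ev f phi.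
Proof.
rewrite -[RHS]addr0 -(ev_zero f) -ev_lin.
by apply: ev_ext => x _; rewrite addr0.
Qed.

Lemma ev_opp m s (f : term K m s) phi : ev f (fun x => - phi x) = - ev f phi.
Proof. by rewrite -mulN1r -ev_scale; apply: ev_ext => x _; rewrite mulN1r. Qed.

(** Both sides are the pairing of [phi] with the tensor product of two elements
    of free modules; the interchange law rests on this. *)
Lemma ev_swap m s m' s' (f : term K m s) (g : term K m' s') phi :
  ev f (fun x => ev g (fun y => phi x y)) = ev g (fun y => ev f (fun x => phi x y)).
Proof.
elim: f phi => {m s} /=
  [n|m n s h IHh f IHf|m s m1 s1 f IHf h IHh|||
  |m s|m s f IHf|m s f IHf h IHh|m s b f IHf] phi //.
- by rewrite -IHh; apply: ev_ext => y _; rewrite IHf.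
- by rewrite -IHf; apply: ev_ext => y _; rewrite IHh.
- by rewrite ev_zero.
- by rewrite IHf ev_opp.
- by rewrite IHf IHh ev_add.
- by rewrite IHf ev_scale.
Qed.

Lemma ev_cast m m' s s' (em : m = m') (es : s = s') (f : term K m s) phi :
  ev (cast_term em es f) phi = ev f phi.
Proof. by case: m' / em; case: s' / es. Qed.

(** Well-definedness of the functor from the Brauer category to the free
    category on matrices. *)
Lemma ev_sound m s (f g : term K m s) :
  term_eq f g -> forall phi, ev f phi = ev g phi.
Proof.
elim=> {m s f g} //=.
- by move=> m s f g h _ fg _ gh phi; rewrite fg.
- move=> m n s g g' f f' _ eqg _ eqf phi; rewrite eqg.
  by apply: ev_ext => y _.
- move=> m s m' s' f f' g g' _ eqf _ eqg phi; rewrite eqf.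
  by apply: ev_ext => y _.
- by move=> m s f f' _ eqf phi; rewrite eqf.
- by move=> m s f f' g g' _ eqf _ eqg phi; rewrite eqf eqg.
- by move=> m s a f f' _ eqf phi; rewrite eqf.
- by move=> m s f phi; apply: ev_ext => x sx; rewrite (bmat_id_comp sx).
- by move=> m s f phi; apply: ev_ext => x sx; rewrite (bmat_comp_id sx).
- move=> m n p s h g f phi.
  apply: ev_ext => z _; apply: ev_ext => y _; apply: ev_ext => x _.
  by rewrite bmat_compA.
- by move=> m n phi; rewrite bmat_tens_id.
- move=> m n s m' n' s' g f g' f' phi.
  (* The two sides run through [f] and [g'] in opposite orders. *)
  apply: ev_ext => y sy; rewrite ev_swap.
  apply: ev_ext => y' sy'; apply: ev_ext => x sx; apply: ev_ext => x' sx'.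
  by rewrite (bmat_interchange sx sy sx' sy').
- by move=> m s f phi; apply: ev_ext => x _; rewrite bmat_unit_tens.
- move=> m s f phi; rewrite ev_cast /=; apply: ev_ext => x sx.
  by rewrite (bmat_tens_unit sx).
- move=> m s m' s' m'' s'' f g h phi; rewrite ev_cast /=.
  apply: ev_ext => x _; apply: ev_ext => y _; apply: ev_ext => z _.
  by rewrite bmat_tensA.
- by move=> m s f g h phi; rewrite addrA.
- by move=> m s f g phi; rewrite addrC.
- by move=> m s f phi; rewrite add0r.
- by move=> m s f phi; rewrite addNr.
- by move=> m s a b f phi; rewrite mulrA.
- by move=> m s f phi; rewrite mul1r.
- by move=> m s a f g phi; rewrite mulrDr.
- by move=> m s a b f phi; rewrite mulrDl.
- by move=> m n s g f f' phi; rewrite -ev_add.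
- by move=> m n s a g f phi; rewrite -ev_scale.
- by move=> m s m' s' f g g' phi; rewrite -ev_add.
- by move=> m s m' s' a f g phi; rewrite -ev_scale.
- by move=> phi; rewrite bmat_SS.
- by move=> phi; rewrite bmat_braid.
- by move=> phi; rewrite bmat_zigzagl.
- by move=> phi; rewrite bmat_zigzagr.
- by move=> phi; rewrite bmat_SU.
- by move=> phi; rewrite bmat_AS.
- by move=> phi; rewrite bmat_slideA.
- by move=> phi; rewrite bmat_slideU.
Qed.

End Evaluation.

(** * The matrix of a diagram counts colourings of its drawing *)

Fixpoint dmat m s (d : diagram m s) : bmat :=
  match d with
  | dEmpty => bmat_id 0
  | dStrand => bmat_id 1
  | dU => bmat_U
  | dA => bmat_A
  | dS => bmat_S
  | dComp m n s g f => bmat_comp n (dmat g) (dmat f)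
  | dTens m s m' s' f g => bmat_tens m s (dmat f) (dmat g)
  end.

Lemma dmat_supp m s (d : diagram m s) : bmat_supp m s (dmat d).
Proof. by elim: d => /=; eauto with bsupp. Qed.

Lemma ev_diagram (K : comPzRingType) m s (d : diagram m s) phi :
  ev (diagram_term K d) phi = phi (dmat d).
Proof.
elim: d phi => //= [{}m n {}s g IHg f IHf|{}m {}s m' s' f IHf g IHg] phi.
  by rewrite IHg IHf.
by rewrite IHf IHg.
Qed.

Lemma glued_sym m s (d : diagram m s) : symmetric (@glued _ _ (draw d)).
Proof.
elim: d => // {m s} [m n s g IHg f IHf|m s m' s' f IHf g IHg] [x|x] [y|y] //=;
  by [apply: IHf | apply: IHg].
Qed.

Definition ffglue (S T : finType) (a : {ffun S -> bool}) (b : {ffun T -> bool}) :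
    {ffun S + T -> bool} :=
  [ffun x => match x with inl y => a y | inr y => b y end].

Lemma sum_ffglue (S T : finType) (F : {ffun S + T -> bool} -> nat) :
  \sum_c F c = \sum_a \sum_b F (ffglue a b).
Proof.
rewrite pair_bigA (reindex (fun p => ffglue p.1 p.2)) //=.
exists (fun c => ([ffun x => c (inl x)], [ffun y => c (inr y)])) => [[a b]|c] _ /=.
  by congr pair; apply/ffunP => x; rewrite !ffunE.
by apply/ffunP => -[x|y]; rewrite !ffunE.
Qed.

Lemma sum_ffun_unit (F : {ffun unit -> bool} -> nat) :
  \sum_c F c = F [ffun=> true] + F [ffun=> false].
Proof.
rewrite (reindex (fun b : bool => [ffun=> b])) ?big_bool //=.
exists (fun c => c tt) => [b|c] _; first by rewrite ffunE.
by apply/ffunP => -[]; rewrite ffunE.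
Qed.

Lemma sum_ffun_bool (F : {ffun bool -> bool} -> nat) :
  \sum_c F c = \sum_(a : bool) \sum_(b : bool) F [ffun x => if x then a else b].
Proof.
rewrite pair_bigA (reindex (fun p : bool * bool => [ffun x => if x then p.1 else p.2])) //=.
exists (fun c => (c true, c false)) => [[a b]|c] _; first by rewrite !ffunE.
by apply/ffunP => -[]; rewrite ffunE.
Qed.

Lemma enum_ord_add m n :
  enum 'I_(m + n) = map (@lshift m n) (enum 'I_m) ++ map (@rshift m n) (enum 'I_n).
Proof.
apply: (@inj_map _ _ (val : 'I_(m + n) -> nat) val_inj).
rewrite (val_enum_ord (m + n)) map_cat iotaD.
rewrite -(map_comp val (@lshift m n)) -(map_comp val (@rshift m n)).
congr cat; first by rewrite -(val_enum_ord m); apply: eq_map.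
rewrite add0n -[m in iota m n]addn0 iotaDl -(val_enum_ord n) -(map_comp (addn m)).
exact: eq_map.
Qed.

Lemma bsum_sum (T : finType) n (F : T -> seq bool -> nat) :
  bsum n (fun v => \sum_c F c v) = \sum_c bsum n (F c).
Proof.
elim: n F => //= n IHn F; rewrite !IHn -big_split /=; exact: eq_bigr.
Qed.

Lemma cat_eqE (T : eqType) (x y u : seq T) m :
  size x = m -> (x ++ y == u) = (x == take m u) && (y == drop m u).
Proof.
move=> sx; apply/eqP/andP => [<-|[/eqP -> /eqP ->]]; last exact: cat_take_drop.
by rewrite take_size_cat // drop_size_cat // !eqxx.
Qed.

Section Colourings.
Variables (m s : nat) (D : drawing m s).

Definition proper (c : {ffun arc D -> bool}) :=
  [forall x, forall y, glued x y ==> (c x == c y)].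

Definition bottom_bits (c : {ffun arc D -> bool}) :=
  [seq c (bottom_arc D i) | i <- enum 'I_m].

Definition top_bits (c : {ffun arc D -> bool}) :=
  [seq c (top_arc D i) | i <- enum 'I_s].

Definition colourings (u w : seq bool) : nat :=
  \sum_(c : {ffun arc D -> bool})
    [&& proper c, bottom_bits c == u & top_bits c == w].

Lemma size_bottom_bits c : size (bottom_bits c) = m.
Proof. by rewrite size_map size_enum_ord. Qed.

Lemma size_top_bits c : size (top_bits c) = s.
Proof. by rewrite size_map size_enum_ord. Qed.

Lemma properP (c : {ffun arc D -> bool}) :
  reflect (forall x y, glued x y -> c x = c y) (proper c).
Proof.
apply: (iffP forallP) => [h x y xy|h x]; last first.
  by apply/forallP => y; apply/implyP => /h ->.
by have /forallP/(_ y)/implyP/(_ xy)/eqP := h x.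
Qed.

End Colourings.

Lemma colourings_single m s u w : colourings (draw_single m s) u w =
  ((nseq m true == u) && (nseq s true == w)) +
  ((nseq m false == u) && (nseq s false == w)).
Proof.
rewrite /colourings sum_ffun_unit.
have prop c : proper (D := draw_single m s) c by apply/properP.
have bits b n : [seq [ffun=> b] tt | i <- enum 'I_n] = nseq n b.
  have mapc (l : seq 'I_n) : [seq b | _ <- l] = nseq (size l) b.
    by elim: l => //= _ l ->.
  by rewrite ffunE mapc size_enum_ord.
by rewrite !prop /bottom_bits /top_bits /= !bits.
Qed.

Lemma colourings_crossing u w : colourings draw_crossing u w = bmat_S u w.
Proof.
rewrite /colourings sum_ffun_bool !big_bool.
have prop c : proper (D := draw_crossing) c by apply/properP.
rewrite !prop /bottom_bits /top_bits /= !enum_ordSl !enum_ord0 /= !ffunE /=.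
by case: u => [|[] [|[] [|c u]]] //=; rewrite ?addn0 ?add0n eq_sym.
Qed.

Lemma colourings_empty u w : colourings draw_empty u w = bmat_id 0 u w.
Proof.
rewrite /colourings (big_pred1 [ffun x : void => true]); last first.
  by move=> c; symmetry; apply/eqP/ffunP => -[].
rewrite (_ : proper _); last by apply/properP => -[].
rewrite /bottom_bits /top_bits /= !enum_ord0 /=.
by case: u => //; case: w.
Qed.

(** A colouring of the composite is a pair of colourings that agree along the
    middle row; sorting the pairs by the colours of that row gives the matrix
    product. *)
Lemma colourings_comp m n s (D : drawing n s) (E : drawing m n) u w :
  colourings (draw_comp D E) u w =
  bmat_comp n (colourings D) (colourings E) u w.
Proof.
rewrite /bmat_comp /colourings sum_ffglue.
under [RHS]eq_bsum => v _ do rewrite big_distrl.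
rewrite bsum_sum; apply: eq_bigr => a _ /=.
under [RHS]eq_bsum => v _ do rewrite big_distrr.
rewrite bsum_sum; apply: eq_bigr => b _ /=.
have propE : proper (D := draw_comp D E) (ffglue a b)
    = [&& proper a, proper b & top_bits a == bottom_bits b].
  apply/properP/and3P => [h|[/properP pa /properP pb /eqP ab]].
    split; first by apply/properP => x y xy; have := h (inl x) (inl y) xy; rewrite !ffunE.
      by apply/properP => x y xy; have := h (inr x) (inr y) xy; rewrite !ffunE.
    apply/eqP/eq_map => i; have := h (inl (top_arc E i)) (inr (bottom_arc D i)).
    by rewrite !ffunE; apply => /=; apply/existsP; exists i; rewrite !eqxx.
  have abi i : a (top_arc E i) = b (bottom_arc D i).
    have /(congr1 (fun v => nth false v i)) := ab.
    by do 2!rewrite (nth_map i) ?size_enum_ord // nth_ord_enum.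
  move=> [x|x] [y|y] /=; rewrite !ffunE; [exact: pa| | |exact: pb];
  by move=> /existsP[i /andP[/eqP <- /eqP <-]].
have -> : bottom_bits (D := draw_comp D E) (ffglue a b) = bottom_bits a.
  by apply: eq_map => i; rewrite !ffunE.
have -> : top_bits (D := draw_comp D E) (ffglue a b) = top_bits b.
  by apply: eq_map => i; rewrite !ffunE.
rewrite propE.
(* The colours [v] of the middle row are forced by [a]: only one summand is left. *)
transitivity (bsum n (fun v => ((size (top_bits a) == n) && (top_bits a == v)) *
   (proper a && (bottom_bits a == u) &&
    (proper b && (v == bottom_bits b) && (top_bits b == w))))).
  rewrite bsum_pick size_top_bits eqxx mul1n; congr nat_of_bool.
  by do !case: (_ == _); do !case: proper.
apply: eq_bsum => v _; rewrite size_top_bits eqxx /= !mulnb; congr nat_of_bool.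
rewrite [v == _]eq_sym.
by do !case: (_ == _); do !case: proper.
Qed.

Lemma colourings_tens m s m' s' (D : drawing m s) (E : drawing m' s') u w :
  colourings (draw_tens D E) u w =
  bmat_tens m s (colourings D) (colourings E) u w.
Proof.
rewrite /bmat_tens /colourings sum_ffglue big_distrl; apply: eq_bigr => a _ /=.
rewrite big_distrr; apply: eq_bigr => b _ /=.
have propE : proper (D := draw_tens D E) (ffglue a b) = proper a && proper b.
  apply/properP/andP => [h|[/properP pa /properP pb]].
    split; first by apply/properP => x y xy; have := h (inl x) (inl y) xy; rewrite !ffunE.
    by apply/properP => x y xy; have := h (inr x) (inr y) xy; rewrite !ffunE.
  by move=> [x|x] [y|y] //=; rewrite !ffunE; [exact: pa | exact: pb].
have bitsE k k' (p : 'I_k -> arc D) (p' : 'I_k' -> arc E) :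
  [seq ffglue a b (match split i with inl j => inl (p j) | inr j => inr (p' j) end)
    | i <- enum 'I_(k + k')] =
  [seq a (p i) | i <- enum 'I_k] ++ [seq b (p' i) | i <- enum 'I_k'].
  rewrite enum_ord_add map_cat.
  rewrite -(map_comp _ (@lshift k k')) -(map_comp _ (@rshift k k')).
  congr cat; apply: eq_map => i /=.
    by rewrite -[lshift _ _]/(unsplit (inl i)) unsplitK ffunE.
  by rewrite -[rshift _ _]/(unsplit (inr i)) unsplitK ffunE.
rewrite {1}/bottom_bits {1}/top_bits /= !bitsE propE.
rewrite (cat_eqE _ _ (size_bottom_bits a)) (cat_eqE _ _ (size_top_bits a)).
rewrite mulnb; congr nat_of_bool.
by rewrite /bottom_bits /top_bits; do !case: (_ == _); do !case: proper.
Qed.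

Lemma dmat_colourings m s (d : diagram m s) : dmat d = colourings (draw d).
Proof.
elim: d => {m s} /= [|||||m n s g -> f ->|m s m' s' f -> g ->];
  apply/funext => u; apply/funext => w.
- by rewrite colourings_empty.
- rewrite colourings_single /bmat_id /=.
  by case: u => [|[] [|a u]] //; case: w => [|[] [|b w]].
- rewrite colourings_single /bmat_U /=.
  by case: u => [|a u] //; case: w => [|[] [|[] [|c w]]].
- rewrite colourings_single /bmat_A /bmat_U /=.
  by case: w => [|a w]; case: u => [|[] [|[] [|c u]]].
- by rewrite colourings_crossing.
- by rewrite colourings_comp.
- by rewrite colourings_tens.
Qed.

(** * Colourings, strands and bubbles *)

Lemma const_connect (T : finType) (e : rel T) (C : Type) (c : T -> C) :
  (forall x y, e x y -> c x = c y) -> forall x y, connect e x y -> c x = c y.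
Proof.
move=> ce x y /connectP[q]; elim: q x => [|z q IHq] x /=; first by move=> _ ->.
by case/andP=> xz zq yl; rewrite (ce _ _ xz) (IHq z zq yl).
Qed.

Section CountColourings.
Variables (T : finType) (e : rel T) (k : nat) (p : 'I_k -> T).
Hypothesis e_sym : symmetric e.

(** For a drawing with boundary points [p], the vertices on bubbles. *)
Definition off_boundary : pred T := [pred x | [forall i, ~~ connect e (p i) x]].

Lemma connect_sym_of_sym : connect_sym e.
Proof. exact: sym_connect_sym. Qed.

Lemma connect_class x y : connect e x y -> connect e x =1 connect e y.
Proof. by move=> xy z; apply: (same_connect connect_sym_of_sym). Qed.

(** A colouring is constant on connected components.  On those that meet the
    boundary it is prescribed by [u], and on the others it is free; so it
    amounts to the set of roots off the boundary that have the colour [true]. *)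
Lemma card_colourings (u : 'I_k -> bool) :
  (forall i j, connect e (p i) (p j) -> u i = u j) ->
  #|[set c : {ffun T -> bool} |
      [forall x, forall y, e x y ==> (c x == c y)] && [forall i, c (p i) == u i]]|
  = 2 ^ n_comp e off_boundary.
Proof.
move=> u_compat.
set C := [set c | _]; pose R := [set x | roots e x && off_boundary x].
have CP (c : {ffun T -> bool}) : reflect
    ((forall x y, connect e x y -> c x = c y) /\ forall i, c (p i) = u i)
    (c \in C).
  rewrite inE; apply: (iffP andP) => -[ce cu]; split.
  - apply: const_connect => x y xy.
    by have /forallP/(_ x)/forallP/(_ y)/implyP/(_ xy)/eqP := ce.
  - by move=> i; have /forallP/(_ i)/eqP := cu.
  - apply/forallP => x; apply/forallP => y; apply/implyP => xy.
    by rewrite (ce x y (connect1 xy)).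
  - by apply/forallP => i; rewrite cu.
have -> : n_comp e off_boundary = #|R|.
  by rewrite /n_comp_mem; apply: eq_card => x; rewrite !inE.
rewrite -card_powerset.
pose res (c : {ffun T -> bool}) := [set x in R | c x].
have unb_root x : off_boundary x -> fingraph.root e x \in R.
  move=> /forallP ux; rewrite inE (roots_root connect_sym_of_sym) /=.
  apply/forallP => i; apply: contra (ux i) => /connect_trans; apply.
  by rewrite connect_sym_of_sym connect_root.
have res_inj : {in C &, injective res}.
  move=> c c' /CP[ce cu] /CP[ce' cu'] eqr; apply/ffunP => x.
  have [ux|] := boolP (off_boundary x).
    rewrite (ce _ _ (connect_root e x)) (ce' _ _ (connect_root e x)).
    have := unb_root x ux; rewrite inE => rR.
    by have /setP/(_ (fingraph.root e x)) := eqr; rewrite !inE rR.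
  rewrite negb_forall => /existsP[i /negPn px].
  by rewrite -(ce _ _ px) -(ce' _ _ px) cu cu'.
rewrite -(card_in_imset res_inj); apply: eq_card => B.
apply/imsetP/idP => [[c _ ->]|].
  by rewrite inE; apply/subsetP => x; rewrite inE => /andP[].
rewrite inE => /subsetP BR.
pose c := [ffun x => if [pick i | connect e (p i) x] is Some i then u i
                     else fingraph.root e x \in B].
exists c.
  apply/CP; split=> [x y xy|i]; rewrite !ffunE.
    have eqp : (fun i => connect e (p i) x) =1 (fun i => connect e (p i) y).
      by move=> i; rewrite !(connect_sym_of_sym (p i)) (connect_class xy).
    by rewrite (eq_pick eqp) (fingraph.rootP connect_sym_of_sym xy).
  case: pickP => [j|/(_ i)]; first exact: u_compat.
  by rewrite connect0.
apply/setP => x; rewrite !inE; have [xB|nxB] := boolP (x \in B).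
  have := BR x xB; rewrite inE => /andP[rx ux]; rewrite rx ux ffunE.
  case: pickP => [i pix|_]; first by move/forallP/(_ i): ux; rewrite pix.
  by rewrite (eqP rx) xB.
apply/esym/negbTE; apply/negP => /andP[/andP[rx ux]].
rewrite ffunE; case: pickP => [i pix|_]; first by move/forallP/(_ i): ux; rewrite pix.
by rewrite (eqP rx) (negbTE nxB).
Qed.

End CountColourings.

Section DiagramCount.
Variables (m s : nat) (d : diagram m s).

Lemma joined_equiv : equivalence_rel (joined d).
Proof.
move=> x y z; split; first exact: connect0.
by move=> xy; apply: (connect_class (@glued_sym m s d) xy).
Qed.

Lemma endpoint_colours (c : {ffun arc (draw d) -> bool}) :
  [seq c (endpoint_arc d i) | i <- enum 'I_(m + s)] = bottom_bits c ++ top_bits c.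
Proof.
rewrite enum_ord_add map_cat -(map_comp _ (@lshift m s)) -(map_comp _ (@rshift m s)).
congr cat; apply: eq_map => i /=; rewrite /endpoint_arc.
  by rewrite -[lshift _ _]/(unsplit (inl i)) unsplitK.
by rewrite -[rshift _ _]/(unsplit (inr i)) unsplitK.
Qed.

Lemma dmat_count (b : 'I_(m + s) -> bool) :
  dmat d (take m [seq b i | i <- enum 'I_(m + s)])
         (drop m [seq b i | i <- enum 'I_(m + s)])
  = [forall i, forall j, joined d i j ==> (b i == b j)] * 2 ^ bubbles d.
Proof.
set bs := [seq b i | i <- _].
have bitsE c : proper c && (bottom_bits c == take m bs) && (top_bits c == drop m bs)
  = (c \in [set c : {ffun arc (draw d) -> bool} | proper c &&
      [forall i, c (endpoint_arc d i) == b i]]).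
  rewrite inE -andbA -(cat_eqE _ _ (size_bottom_bits c)) -endpoint_colours; congr andb.
  apply/eqP/forallP => [|eqb]; last by apply: eq_map => i; exact/eqP.
  by move/eq_in_map => eqb i; apply/eqP/eqb; rewrite mem_enum.
rewrite dmat_colourings /colourings; under eq_bigr do rewrite andbA bitsE.
rewrite -big_mkcond /= sum1_card.
case: (boolP [forall i, _]) => [/forallP compat|ncompat].
  rewrite mul1n card_colourings //; first exact: glued_sym.
  by move=> i j ij; have /forallP/(_ j)/implyP/(_ ij)/eqP := compat i.
rewrite mul0n; apply/eqP; rewrite cards_eq0; apply/eqP/setP => c; rewrite !inE.
apply/negbTE; apply: contra ncompat => /andP[/properP pc /forallP cb].
apply/forallP => i; apply/forallP => j; apply/implyP => ij.
rewrite -(eqP (cb i)) -(eqP (cb j)).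
by rewrite (const_connect pc ij).
Qed.

End DiagramCount.

(** The monochromatic colouring reads off the number of bubbles from the matrix.
    The strands are read off from the zero entries: the colouring of the
    endpoints that marks those joined to [i] is constant along strands, so the
    entry is nonzero, and it would be zero for a diagram joining [i] to an
    endpoint outside this set. *)
Lemma diagram_equiv_dmat m s (d d' : diagram m s) :
  diagram_equiv d d' <-> dmat d = dmat d'.
Proof.
split=> [/andP[/eqP eqb /eqP eqp]|eqd].
  have eqj : joined d =2 joined d'.
    move=> i j.
    have pb (f : diagram m s) : joined f i j = (j \in pblock (strand_partition f) i).
      by rewrite pblock_equivalence_partition ?inE // => x y z _ _ _; exact: joined_equiv.
    by rewrite !pb eqp.
  apply: (bmat_ext (dmat_supp d) (dmat_supp d')) => u w su sw.
  pose b (i : 'I_(m + s)) := nth false (u ++ w) i.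
  have bsE : [seq b i | i <- enum 'I_(m + s)] = u ++ w.
    apply: (@eq_from_nth _ false); rewrite size_map size_enum_ord ?size_cat ?su ?sw //.
    move=> i lti; rewrite (nth_map (Ordinal lti)) ?size_enum_ord //.
    by rewrite /b (nth_enum_ord (Ordinal lti)).
  have := dmat_count d b; have := dmat_count d' b; rewrite bsE.
  rewrite take_size_cat // drop_size_cat // eqb => -> ->; congr (nat_of_bool _ * _).
  by apply: eq_forallb => i; apply: eq_forallb => j; rewrite eqj.
have eqc (b : 'I_(m + s) -> bool) :
    [forall i, forall j, joined d i j ==> (b i == b j)] * 2 ^ bubbles d
  = [forall i, forall j, joined d' i j ==> (b i == b j)] * 2 ^ bubbles d'.
  by rewrite -(dmat_count d b) -(dmat_count d' b) eqd.
have eqb : bubbles d = bubbles d'.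
  have allt (f : diagram m s) :
    [forall i, forall j, joined f i j ==> ((fun=> true) i == (fun=> true) j)].
    by apply/forallP => i; apply/forallP => j; apply/implyP.
  have := eqc (fun=> true); rewrite !allt !mul1n => /eqP.
  by rewrite eqn_exp2l // => /eqP.
have sub (f f' : diagram m s) : bubbles f = bubbles f' -> (forall b : 'I_(m + s) -> bool,
    [forall i, forall j, joined f i j ==> (b i == b j)] * 2 ^ bubbles f
  = [forall i, forall j, joined f' i j ==> (b i == b j)] * 2 ^ bubbles f') ->
  forall i j, joined f i j -> joined f' i j.
  move=> eqbf eqf i j ij; have := eqf (joined f' i).
  rewrite eqbf => /eqP; rewrite eqn_pmul2r ?expn_gt0 //.
  have -> : [forall x, forall y, joined f' x y ==> (joined f' i x == joined f' i y)].
    apply/forallP => x; apply/forallP => y; apply/implyP => xy; apply/eqP.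
    rewrite /joined !(connect_sym_of_sym (@glued_sym m s f') (endpoint_arc f' i)).
    by rewrite (connect_class (@glued_sym m s f') xy).
  case: (boolP [forall x, _]) => // /forallP/(_ i)/forallP/(_ j)/implyP/(_ ij)/eqP <- _.
  exact: connect0.
rewrite /diagram_equiv eqb eqxx; apply/eqP; rewrite /strand_partition.
congr equivalence_partition; apply/funext => i; apply/funext => j.
by apply/idP/idP; apply: sub.
Qed.

(** * The matrix of an inserted cup *)

Definition bmat_slice a m s b (M : bmat) : bmat :=
  bmat_tens (a + m) (a + s) (bmat_tens a a (bmat_id a) M) (bmat_id b).

(** The effect on matrices of adding a cup at the far left and moving its right
    leg past [i] strands, one crossing at a time; [j] strands stay to its right.
    Here and below, [j] grows by one for each crossing that is taken away, since
    the strand that was crossed then lies to the right of the leg. *)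
Fixpoint bmat_insert i j (M : bmat) : bmat :=
  if i is i'.+1
  then bmat_comp (i + j.+2) (bmat_slice i 2 2 j bmat_S) (bmat_insert i' j.+1 M)
  else bmat_comp j (bmat_slice 0 0 2 j bmat_U) M.

Fixpoint bmat_bubbles b : bmat :=
  if b is b'.+1 then bmat_tens 0 0 (bmat_comp 2 bmat_A bmat_U) (bmat_bubbles b')
  else bmat_id 0.

Lemma bsum_pickr n F w :
  size w = n -> bsum n (fun v => F v * bmat_id n v w) = F w.
Proof.
move=> sw; transitivity (bsum n (fun v => ((size w == n) && (w == v)) * F v)).
  apply: eq_bsum => v sv.
  by rewrite /bmat_id sv sw eqxx [w == v]eq_sym mulnC.
by rewrite bsum_pick sw eqxx mul1n.
Qed.

Lemma bmat_slice_cat a m s b M u1 u2 u3 w1 w2 w3 :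
  size u1 = a -> size u2 = m -> size w1 = a -> size w2 = s ->
  bmat_slice a m s b M (u1 ++ u2 ++ u3) (w1 ++ w2 ++ w3) =
  bmat_id a u1 w1 * M u2 w2 * bmat_id b u3 w3.
Proof.
move=> su1 su2 sw1 sw2; rewrite /bmat_slice /bmat_tens !catA.
have szu : size (u1 ++ u2) = a + m by rewrite size_cat su1 su2.
have szw : size (w1 ++ w2) = a + s by rewrite size_cat sw1 sw2.
by rewrite !take_size_cat // !drop_size_cat.
Qed.

(** The legs of the inserted cup are the positions of [a] and [c], so these must
    have the same colour. *)
Lemma bmat_insertE i j M u a v1 c v2 : size v1 = i -> size v2 = j ->
  bmat_insert i j M u (a :: v1 ++ c :: v2) = M u (v1 ++ v2) * (a == c).
Proof.
elim: i j a v1 c v2 => [|i IHi] j a v1 c v2.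
  case: v1 => // _ sv2; rewrite /= /bmat_comp.
  under eq_bsum => v _.
    rewrite (@bmat_slice_cat 0 0 2 j bmat_U [::] [::] v [::] [:: a; c] v2) //.
    rewrite mul1n mulnA; over.
  by rewrite bsum_pickr.
(* The last crossing exchanges [c] with the last colour [b] of [v1]. *)
elim/last_ind: v1 => // v1 b _; rewrite size_rcons => -[sv1] sv2.
rewrite cat_rcons /= /bmat_comp.
have -> : i.+1 + j.+2 = i.+1 + (2 + j) by lia.
rewrite bsum_cat.
transitivity (bsum i.+1 (fun t1 => bsum 2 (fun t2 => bsum j (fun t3 =>
    bmat_insert i j.+1 M u (t1 ++ t2 ++ t3)
      * (bmat_id i.+1 t1 (a :: v1) * bmat_S t2 [:: b; c]) * bmat_id j t3 v2)))).
  apply: eq_bsum => t1 st1; rewrite bsum_cat; apply: eq_bsum => t2 st2.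
  apply: eq_bsum => t3 st3; rewrite -mulnA; congr (_ * _).
  by rewrite -(@bmat_slice_cat i.+1 2 2 j) //= sv1.
transitivity (bsum i.+1 (fun t1 => bmat_insert i j.+1 M u (t1 ++ [:: c; b] ++ v2)
    * bmat_id i.+1 t1 (a :: v1))).
  apply: eq_bsum => t1 st1.
  under eq_bsum => t2 _ do rewrite bsum_pickr //.
  by case: b; case: c; rewrite /= ?muln0 ?addn0 ?add0n muln1.
rewrite bsum_pickr /= ?sv1 // IHi //= ?sv2 //.
by rewrite cat_rcons.
Qed.

(** * Morphisms of the Brauer category with untyped operations *)

Section Morphisms.
Variable K : comPzRingType.

(** Morphisms with arbitrary source and target form one type, in which the laws
    of a strict monoidal category are plain equalities that need no transport
    along equalities of objects. *)
Record bmor := Bmor { bdom : nat; bcod : nat; bhom : brauer_hom K bdom bcod }.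

Definition cls m s (f : term K m s) : bmor :=
  Bmor (\pi_(brauer_hom K m s)%qT f).

Definition bzero m s : bmor := cls (tZero m s).

(** A composition with mismatched objects is zero.  As zero is absorbing,
    composition is then associative on all of [bmor] ([bcompA]). *)
Definition bcomp (y x : bmor) : bmor :=
  if bcod x =P bdom y is ReflectT e
  then cls (tComp (repr (bhom y)) (ecast n (term K (bdom x) n) e (repr (bhom x))))
  else bzero (bdom x) (bcod y).

Definition btens (x y : bmor) : bmor :=
  cls (tTens (repr (bhom x)) (repr (bhom y))).

Definition bid n := cls (tId n).

Local Notation "g \o f" := (bcomp g f) (at level 50, f at next level).
Local Notation "f ** g" := (btens f g) (at level 40, left associativity).
Local Notation I := bid.
Local Notation U := (cls tU).
Local Notation A := (cls tA).
Local Notation X := (cls tS).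

Lemma eq_cls m s (f g : term K m s) : term_eq f g -> cls f = cls g.
Proof. by move=> fg; congr Bmor; apply/pi_homP. Qed.

(** Reads a morphism back at given objects, which gives the injectivity of
    [cls]. *)
Definition bhom_at m s (x : bmor) : brauer_hom K m s :=
  if bdom x =P m is ReflectT em then
    if bcod x =P s is ReflectT es then
      ecast m' (brauer_hom K m' s) em (ecast s' (brauer_hom K (bdom x) s') es (bhom x))
    else 0%R
  else 0%R.

Lemma cls_inj m s (f g : term K m s) : cls f = cls g -> term_eq f g.
Proof.
move/(congr1 (bhom_at m s)); rewrite /bhom_at /=.
case: eqP => // em; case: eqP => // es.
by rewrite !eq_axiomK /= => /pi_homP.
Qed.

Lemma clsP (P : bmor -> Prop) : (forall m s (f : term K m s), P (cls f)) ->
  forall x, P x.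
Proof. by move=> h [m s]; elim/quotW=> f; exact: h. Qed.

Lemma cls_cast m m' s s' (em : m = m') (es : s = s') (f : term K m s) :
  cls (cast_term em es f) = cls f.
Proof. by case: m' / em; case: s' / es. Qed.

Lemma cls_comp m n s (g : term K n s) (f : term K m n) :
  cls g \o cls f = cls (tComp g f).
Proof.
rewrite /bcomp /=; case: eqP => // e; rewrite eq_axiomK /=.
by apply/eq_cls/te_comp; exact: repr_pi.
Qed.

Lemma cls_tens m s m' s' (f : term K m s) (g : term K m' s') :
  cls f ** cls g = cls (tTens f g).
Proof. by apply/eq_cls/te_tens; exact: repr_pi. Qed.

Lemma bcomp_mismatch y x : bcod x <> bdom y -> y \o x = bzero (bdom x) (bcod y).
Proof. by rewrite /bcomp; case: eqP. Qed.

Lemma bdom_comp y x : bdom (y \o x) = bdom x.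
Proof. by rewrite /bcomp; case: eqP. Qed.

Lemma bcod_comp y x : bcod (y \o x) = bcod y.
Proof. by rewrite /bcomp; case: eqP. Qed.

Lemma te_scale0 m s (f : term K m s) : term_eq (tScale 0%R f) (tZero m s).
Proof. by apply/pi_homP; rewrite -hom_scaleE; exact: scale0r. Qed.

Lemma te_comp_zero m n s (g : term K n s) :
  term_eq (tComp g (tZero m n)) (tZero m s).
Proof.
apply: te_trans (te_scale0 (tComp g (tZero m n))).
apply: te_trans (te_compZr _ _ _); apply: te_comp (te_refl _) _.
exact/te_sym/te_scale0.
Qed.

Lemma te_zero_comp m n s (f : term K m n) :
  term_eq (tComp (tZero n s) f) (tZero m s).
Proof.
apply: te_trans (te_scale0 (tComp (tZero n s) f)).
apply: te_trans (te_compZl _ _ _); apply: te_comp (te_refl _).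
exact/te_sym/te_scale0.
Qed.

Lemma te_zero_tens m s m' s' (f : term K m' s') :
  term_eq (tTens (tZero m s) f) (tZero (m + m') (s + s')).
Proof.
apply: te_trans (te_scale0 (tTens (tZero m s) f)).
apply: te_trans (te_tensZl _ _ _); apply: te_tens (te_refl _).
exact/te_sym/te_scale0.
Qed.

Lemma te_tens_zero m s m' s' (f : term K m s) :
  term_eq (tTens f (tZero m' s')) (tZero (m + m') (s + s')).
Proof.
apply: te_trans (te_scale0 (tTens f (tZero m' s'))).
apply: te_trans (te_tensZr _ _ _); apply: te_tens (te_refl _) _.
exact/te_sym/te_scale0.
Qed.

Lemma bcomp_zero y m n : y \o bzero m n = bzero m (bcod y).
Proof.
have [e|] := @eqP _ n (bdom y); last by move=> ne; rewrite bcomp_mismatch.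
elim/clsP: y e => n' s g /= e; case: n' / e g => g.
by rewrite cls_comp; apply/eq_cls/te_comp_zero.
Qed.

Lemma zero_bcomp x n s : bzero n s \o x = bzero (bdom x) s.
Proof.
have [e|] := @eqP _ (bcod x) n; last by move=> ne; rewrite bcomp_mismatch.
elim/clsP: x e => m n' f /= e; case: n / e.
by rewrite cls_comp; apply/eq_cls/te_zero_comp.
Qed.

Lemma bzero_tens x m s : bzero m s ** x = bzero (m + bdom x) (s + bcod x).
Proof.
by elim/clsP: x => m' s' f; rewrite cls_tens; apply/eq_cls/te_zero_tens.
Qed.

Lemma tens_bzero x m s : x ** bzero m s = bzero (bdom x + m) (bcod x + s).
Proof.
by elim/clsP: x => m' s' f; rewrite cls_tens; apply/eq_cls/te_tens_zero.
Qed.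

Lemma bcompA z y x : z \o (y \o x) = (z \o y) \o x.
Proof.
have [exy|nxy] := @eqP _ (bcod x) (bdom y); last first.
  rewrite (bcomp_mismatch nxy) bcomp_zero bcomp_mismatch ?bdom_comp //.
  by rewrite bcod_comp.
have [eyz|nyz] := @eqP _ (bcod y) (bdom z); last first.
  by rewrite (bcomp_mismatch nyz) zero_bcomp bcomp_mismatch ?bcod_comp // bdom_comp.
elim/clsP: x exy => m n f /=; elim/clsP: y eyz => n' p g /= eyz e.
case: n' / e g => g; elim/clsP: z eyz => p' s h /= e; case: p' / e h => h.
by rewrite !cls_comp; apply/eq_cls/te_compA.
Qed.

Lemma bid_comp n x : bcod x = n -> I n \o x = x.
Proof.
by move <-; elim/clsP: x => m s f /=; rewrite cls_comp; apply/eq_cls/te_id_comp.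
Qed.

Lemma bcomp_id n x : bdom x = n -> x \o I n = x.
Proof.
by move <-; elim/clsP: x => m s f /=; rewrite cls_comp; apply/eq_cls/te_comp_id.
Qed.

Lemma btens_id m n : I m ** I n = I (m + n).
Proof. by rewrite cls_tens; apply/eq_cls/te_tens_id. Qed.

Lemma btensA x y z : x ** (y ** z) = x ** y ** z.
Proof.
elim/clsP: x => m s f; elim/clsP: y => m' s' g; elim/clsP: z => m'' s'' h.
rewrite !cls_tens -(cls_cast (addnA m m' m'') (addnA s s' s'')).
exact/eq_cls/te_tensA.
Qed.

Lemma bid0_tens x : I 0 ** x = x.
Proof. by elim/clsP: x => m s f; rewrite cls_tens; apply/eq_cls/te_unit_tens. Qed.

Lemma btens_id0 x : x ** I 0 = x.
Proof.
elim/clsP: x => m s f; rewrite cls_tens -(cls_cast (addn0 m) (addn0 s)).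
exact/eq_cls/te_tens_unit.
Qed.

Lemma interchange g f g' f' : bcod f = bdom g ->
  (g \o f) ** (g' \o f') = (g ** g') \o (f ** f').
Proof.
move=> efg; have [e'|n'] := @eqP _ (bcod f') (bdom g'); last first.
  rewrite (bcomp_mismatch n') tens_bzero bdom_comp bcod_comp bcomp_mismatch //.
  by rewrite /= efg => /addnI.
elim/clsP: f efg => m n f /=; elim/clsP: g => n1 s g /= e; case: n1 / e g => g.
elim/clsP: f' e' => m' n' f' /=; elim/clsP: g' => n1 s' g' /= e; case: n1 / e g' => g'.
by rewrite !cls_tens !cls_comp cls_tens; apply/eq_cls/te_interchange.
Qed.

(** The morphism [f] with [a] strands to its left and [b] to its right.  All
    diagrams are handled as composites of slices. *)
Definition slice a f b := I a ** f ** I b.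

Definition bmor_ends := (bdom_comp, bcod_comp).

Lemma slice_comp a g f b : slice a (g \o f) b = slice a g b \o slice a f b.
Proof.
have e n : I n = I n \o I n by rewrite bid_comp.
have [efg|nfg] := @eqP _ (bcod f) (bdom g).
  by rewrite /slice {1}[I a]e {1}[I b]e interchange // interchange //= efg.
rewrite (bcomp_mismatch nfg) /slice tens_bzero bzero_tens bcomp_mismatch //=.
by move/addIn/addnI.
Qed.

Lemma slice_slice a c f d b : slice a (slice c f d) b = slice (a + c) f (d + b).
Proof. by rewrite /slice -!btens_id !btensA. Qed.

Lemma slice_id a n b : slice a (I n) b = I (a + n + b).
Proof. by rewrite /slice !btens_id. Qed.

Lemma slice00 f : slice 0 f 0 = f.
Proof. by rewrite /slice bid0_tens btens_id0. Qed.

Lemma btens_slicel f g :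
  f ** g = slice 0 f (bcod g) \o slice (bdom f) g 0.
Proof.
by rewrite /slice bid0_tens btens_id0 -interchange //= bid_comp // bcomp_id.
Qed.

Lemma btens_slicer f g :
  f ** g = slice (bcod f) g 0 \o slice 0 f (bdom g).
Proof.
by rewrite /slice bid0_tens btens_id0 -interchange //= bid_comp // bcomp_id.
Qed.

(** The interchange law, with [f] to the left of [g] and [c] strands between. *)
Lemma slice_far a f c g d :
  slice a f (c + bcod g + d) \o slice (a + bdom f + c) g d =
  slice (a + bcod f + c) g d \o slice a f (c + bdom g + d).
Proof.
have := btens_slicel f (slice c g d); rewrite btens_slicer /=.
move=> /(congr1 (fun x => slice a x 0)); rewrite !slice_comp !slice_slice /=.
by rewrite !add0n !addn0 ?addnA => ->.
Qed.

Lemma relSS : X \o X = I 2.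
Proof. by rewrite cls_comp; exact/eq_cls/te_SS. Qed.

Lemma rel_braid : slice 0 X 1 \o slice 1 X 0 \o slice 0 X 1 =
  slice 1 X 0 \o slice 0 X 1 \o slice 1 X 0.
Proof.
rewrite /slice !bid0_tens !btens_id0 !cls_tens !cls_comp.
exact/eq_cls/te_braid.
Qed.

Lemma rel_zigzagl : slice 1 A 0 \o slice 0 U 1 = I 1.
Proof.
rewrite /slice !bid0_tens !btens_id0 !cls_tens !cls_comp.
exact/eq_cls/te_zigzagl.
Qed.

Lemma rel_zigzagr : slice 0 A 1 \o slice 1 U 0 = I 1.
Proof.
rewrite /slice !bid0_tens !btens_id0 !cls_tens !cls_comp.
exact/eq_cls/te_sym/te_zigzagr.
Qed.

Lemma relSU : X \o U = U.
Proof. by rewrite cls_comp; exact/eq_cls/te_sym/te_SU. Qed.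

Lemma rel_slideA : slice 0 A 1 \o slice 1 X 0 = slice 1 A 0 \o slice 0 X 1.
Proof.
rewrite /slice !bid0_tens !btens_id0 !cls_tens !cls_comp.
exact/eq_cls/te_slideA.
Qed.

Lemma rel_slideU : slice 0 X 1 \o slice 1 U 0 = slice 1 X 0 \o slice 0 U 1.
Proof.
rewrite /slice !bid0_tens !btens_id0 !cls_tens !cls_comp.
exact/eq_cls/te_slideU.
Qed.

(** * Pulling a strand past a diagram *)

(** The leftmost strand crosses the [n] strands to its right. *)
Fixpoint past n : bmor :=
  if n is n'.+1 then slice n' X 0 \o slice 0 (past n') 1 else I 1.

Lemma bdom_past n : bdom (past n) = n.+1.
Proof. by elim: n => //= n IHn; rewrite bdom_comp /= IHn; lia. Qed.

Lemma bcod_past n : bcod (past n) = n.+1.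
Proof. by case: n => //= n; rewrite bcod_comp /=; lia. Qed.

Lemma past1 : past 1 = X.
Proof. by rewrite /= slice00 slice_id bcomp_id. Qed.

Lemma past_add m n : past (m + n) = slice m (past n) 0 \o slice 0 (past m) n.
Proof.
elim: n => [|n IHn].
  by rewrite addn0 slice00 slice_id addn1 addn0 bid_comp // bcod_past.
by rewrite addnS /= IHn !slice_comp !slice_slice bcompA !add0n !addn0 addn1.
Qed.

(** Naturality of the braiding: a strand that crosses all strands of [f] may do
    so before or after [f]. *)
Definition slides (f : bmor) : Prop :=
  past (bcod f) \o slice 1 f 0 = slice 0 f 1 \o past (bdom f).

(** The strand passes first the [a] strands, then [f], then the [b] strands;
    the first and the last crossings commute with [f]. *)
Lemma slides_slice a f b : slides f -> slides (slice a f b).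
Proof.
move=> sf; rewrite /slides /=.
have past3 n : past (a + n + b) =
    slice (a + n) (past b) 0 \o (slice a (past n) b \o slice 0 (past a) (n + b)).
  by rewrite past_add past_add slice_comp !slice_slice bcompA.
rewrite !past3.
have e1 : slice 0 (past a) (bcod f + b) \o slice 1 (slice a f b) 0 =
   slice a.+1 f b \o slice 0 (past a) (bdom f + b).
  have := slice_far 0 (past a) 0 f b; rewrite bdom_past bcod_past !add0n !addn0.
  by rewrite slice_slice addn0 add1n.
have e2 : slice a (past (bcod f)) b \o slice a.+1 f b =
    slice a f b.+1 \o slice a (past (bdom f)) b.
  have := congr1 (fun x => slice a x b) sf; rewrite !slice_comp !slice_slice.
  by rewrite addn0 addn1 add0n add1n.
have e3 : slice (a + bcod f) (past b) 0 \o slice a f b.+1 =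
    slice a f b.+1 \o slice (a + bdom f) (past b) 0.
  have := slice_far a f 0 (past b) 0; rewrite bdom_past bcod_past !add0n !addn0.
  by move <-.
rewrite -!bcompA e1 (bcompA (slice a (past (bcod f)) b)) e2.
rewrite -(bcompA (slice a f b.+1)) (bcompA (slice (a + bcod f) (past b) 0)) e3.
by rewrite slice_slice add0n addn1 !bcompA.
Qed.

Lemma slides_U : slides U.
Proof.
rewrite /slides -[bcod U]/(1 + 1) past_add past1 -bcompA rel_slideU bcompA -slice_comp.
by rewrite relSS slice_id bid_comp // bcomp_id.
Qed.

Lemma slides_S : slides X.
Proof.
rewrite /slides -[bcod X]/(1 + 1) -[bdom X]/(1 + 1) past_add past1.
by rewrite -rel_braid bcompA.
Qed.

(** * Normal forms of diagrams without bottom endpoints *)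

(** A new pair of endpoints: the first one is the leftmost, and the second one
    has [i] of the endpoints of [y] to its left and [j] to its right. *)
Definition insert i j (y : bmor) : bmor :=
  slice 1 (past i) j \o (slice 0 U (i + j) \o y).

Fixpoint bubble_pow b : bmor :=
  if b is b'.+1 then (A \o U) ** bubble_pow b' else I 0.

(** Every perfect matching arises in one way from such insertions, by removing
    the pair of the leftmost endpoint again and again.  The last argument is the
    matrix of the normal form ([nf_has_matrix]). *)
Inductive normal_form : nat -> bmor -> bmat -> Prop :=
| nf_bubbles b : normal_form 0 (bubble_pow b) (bmat_bubbles b)
| nf_insert i j y M : normal_form (i + j) y M ->
    normal_form (i + j).+2 (insert i j y) (bmat_insert i j M).

Lemma bdom_bubble_pow b : bdom (bubble_pow b) = 0.
Proof. by elim: b => //= b ->; rewrite bdom_comp. Qed.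

Lemma bcod_bubble_pow b : bcod (bubble_pow b) = 0.
Proof. by elim: b => //= b ->; rewrite bcod_comp. Qed.

Lemma nf_type n y M : normal_form n y M -> bdom y = 0 /\ bcod y = n.
Proof.
elim=> {n y M} [b|i j y M _ [dy cy]]; first by rewrite bdom_bubble_pow bcod_bubble_pow.
by rewrite /insert !bmor_ends /= bcod_past; split=> //; lia.
Qed.

Definition normal n y := exists M, normal_form n y M.

Lemma normal_type n y : normal n y -> bdom y = 0 /\ bcod y = n.
Proof. by case=> M /nf_type. Qed.

Lemma normal_bubbles b : normal 0 (bubble_pow b).
Proof. by eexists; exact: nf_bubbles. Qed.

Lemma normal_insert n i j y : normal n y -> n = i + j -> normal n.+2 (insert i j y).
Proof. by move=> [M nfy] en; subst n; eexists; exact: nf_insert nfy. Qed.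

Lemma normalS_inv n y : normal n.+2 y ->
  exists i j z, [/\ n = i + j, normal n z & y = insert i j z].
Proof.
move=> [M nfy]; move e: n.+2 nfy => n' nfy.
case: nfy e => [//|i j z N nfz] [en]; subst n.
by exists i, j, z; split=> //; exists N.
Qed.

Lemma normal1_inv y : ~ normal 1 y.
Proof. by move=> [M nfy]; move e: 1 nfy => n nfy; case: nfy e. Qed.

Lemma insertS i j y : insert i.+1 j y = slice i.+1 X j \o insert i j.+1 y.
Proof.
by rewrite /insert /= slice_comp !slice_slice !addn0 !add1n !add0n -!bcompA addSnnS.
Qed.

Lemma insert0 j y : bcod y = j -> insert 0 j y = slice 0 U j \o y.
Proof. by move=> cy; rewrite /insert slice_id bid_comp // bmor_ends /= add0n. Qed.

(** A crossing [slice a.+1 X b] meets [insert i j y] at two endpoints other than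
    the leftmost.  If both lie to the left of the new second endpoint, or both to
    its right ([slice_insert_high]), then the crossing slides down to [y].  If
    the second endpoint is one of the two, the crossing undoes or adds the last
    step of the insertion ([slice_insert_left], [insertS]). *)
Lemma slice_insert_low i j a c y : i = a + 2 + c ->
  slice a.+1 X (c + 1 + j) \o insert i j y = insert i j (slice a X (c + j) \o y).
Proof.
move=> ->; rewrite /insert.
have := congr1 (fun x => slice 1 x j) (slides_slice a c (slides_S)).
rewrite !slice_comp !slice_slice /= !add0n !addn0 => e1.
have := slice_far 0 U a X (c + j); rewrite /= !add0n => e2.
rewrite -addnA -[a.+1]/(1 + a) bcompA -e1 -bcompA; congr (_ \o _).
rewrite !bcompA; congr (_ \o _).
rewrite (_ : a + 2 + c + j = a + 2 + (c + j)); last lia.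
by rewrite e2.
Qed.

Lemma slice_insert_left i j y :
  bcod y = (i.+1 + j) -> slice i.+1 X j \o insert i.+1 j y = insert i j.+1 y.
Proof.
move=> cy; rewrite insertS bcompA -slice_comp relSS slice_id bid_comp //.
by rewrite /insert !bmor_ends /= bcod_past; lia.
Qed.

Lemma slice_insert_high i c b y :
  slice (i + c).+2 X b \o insert i (c + 2 + b) y =
  insert i (c + 2 + b) (slice (i + c) X b \o y).
Proof.
rewrite /insert.
have := slice_far 1 (past i) c X b; rewrite bdom_past bcod_past /=.
rewrite !add1n !addSn => e1.
have := slice_far 0 U (i + c) X b; rewrite /= !add0n => e2.
rewrite bcompA -e1 -bcompA; congr (_ \o _).
rewrite !bcompA; congr (_ \o _).
rewrite (_ : i + (c + 2 + b) = i + c + 2 + b); last lia.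
by rewrite e2.
Qed.

Definition swap_closed n := forall y a b,
  normal n y -> a + 2 + b = n -> normal n (slice a X b \o y).

Lemma normal_swap_pos n : swap_closed n -> forall y a b,
  normal n.+2 y -> a.+1 + 2 + b = n.+2 -> normal n.+2 (slice a.+1 X b \o y).
Proof.
move=> IHn y a b /normalS_inv[i [j [z [en nz ->]]]] eab.
have [lt_a_i|le_i_a] := ltnP a.+1 i.
  pose c := i - a.+2.
  have -> : b = c + 1 + j by rewrite /c; lia.
  rewrite slice_insert_low; last by rewrite /c; lia.
  by apply: normal_insert => //; apply: IHn => //; rewrite /c; lia.
have [eai|nai] := eqVneq i a.+1.
  have eb : b = j by lia.
  rewrite eb eai slice_insert_left; last by rewrite (normal_type nz).2 en eai.
  by apply: normal_insert => //; lia.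
have [eai|nai'] := eqVneq i a.
  have -> : j = b.+1 by lia.
  rewrite -eai -insertS; apply: normal_insert => //; lia.
pose c := a - i.+1.
have -> : a.+1 = (i + c).+2 by rewrite /c; lia.
have -> : j = c + 2 + b by rewrite /c; lia.
rewrite slice_insert_high; apply: normal_insert; last by rewrite /c; lia.
by apply: IHn => //; rewrite /c; lia.
Qed.

(** [past k] is a product of crossings; the bound [lo] keeps track of the
    places at which crossings are already known to preserve normal forms. *)
Lemma normal_past n lo : (forall y a b, lo <= a -> normal n y ->
    a + 2 + b = n -> normal n (slice a X b \o y)) ->
  forall k y a b, lo <= a -> normal n y -> a + k.+1 + b = n ->
    normal n (slice a (past k) b \o y).
Proof.
move=> closed; elim=> [|k IHk] y a b le_a ny en.
  by rewrite slice_id bid_comp // (normal_type ny).2; lia.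
rewrite /= slice_comp !slice_slice addn0 add0n add1n -bcompA.
by apply: closed; [lia | apply: IHk => //; lia | lia].
Qed.

Lemma swap_cup : slice 0 X 1 \o (slice 1 X 0 \o slice 0 U 1) = slice 1 U 0.
Proof.
by rewrite -rel_slideU bcompA -slice_comp relSS slice_id bid_comp.
Qed.

Lemma cap_cup : slice 0 A 1 \o (slice 1 X 0 \o slice 0 U 1) = I 1.
Proof.
by rewrite bcompA rel_slideA -bcompA -slice_comp relSU rel_zigzagl.
Qed.

Lemma insert_pastS k j y : insert k.+1 j y =
  slice 2 (past k) j \o (slice 0 (slice 1 X 0 \o slice 0 U 1) (k + j) \o y).
Proof.
rewrite /insert -(add1n k) past_add past1 !slice_comp !slice_slice !add0n -!bcompA.
by rewrite addn0 -addnA.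
Qed.

(** The right leg of the new cup first crosses the leftmost strand of [y];
    exchanging the two leftmost endpoints pulls that strand out to the left of
    the whole cup ([swap_cup]). *)
Lemma swap0_insert k j y :
  slice 0 X (k + j).+1 \o insert k.+1 j y =
  slice 2 (past k) j \o (slice 1 U (k + j) \o y).
Proof.
have := slice_far 0 X 0 (past k) j; rewrite bcod_past bdom_past /= !add0n addn0 addSn.
move=> e; rewrite insert_pastS bcompA e -bcompA; congr (_ \o _).
rewrite (_ : slice 0 X _ = slice 0 (slice 0 X 1) (k + j)); last by rewrite slice_slice.
by rewrite bcompA -slice_comp swap_cup slice_slice.
Qed.

(** Joining the left leg of the new cup to the leftmost endpoint of [y]
    straightens a zigzag ([cap_cup]), and the strand that ended at this endpoint
    takes the place of the right leg. *)
Lemma cap0_insert k j y : bcod y = (k + j).+1 ->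
  slice 0 A (k + j).+1 \o insert k.+1 j y = slice 0 (past k) j \o y.
Proof.
move=> cy.
have := slice_far 0 A 0 (past k) j; rewrite bcod_past bdom_past /= !add0n addn0 addSn.
move=> e; rewrite insert_pastS bcompA e -bcompA; congr (_ \o _).
rewrite (_ : slice 0 A _ = slice 0 (slice 0 A 1) (k + j)); last by rewrite slice_slice.
by rewrite bcompA -slice_comp cap_cup slice_id bid_comp.
Qed.

(** A cup placed next to the left leg of an inserted cup can be drawn first; the
    right leg of the inserted cup then has two more strands to cross. *)
Lemma cup_insert p q z : slice 1 U (p + q).+1 \o insert p q z =
  insert p.+2 q (slice 0 U (p + q) \o z).
Proof.
have e0 : past p.+2 \o slice 1 (slice 0 U p) 0 = slice 0 (slice 0 U p) 1 \o past p.
  exact: (slides_slice 0 p (slides_U)).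
have := congr1 (fun x => slice 1 x q) e0.
rewrite (slice_comp 1 (past p.+2)) (slice_comp 1 (slice _ _ 1)) !slice_slice.
rewrite !add0n !addn0 (addnCA p 1 q) => e1.
rewrite /insert -[(p + q).+1]/(1 + (p + q)) !bcompA -e1 -!bcompA; congr (_ \o _).
rewrite !bcompA; congr (_ \o _).
have := slice_far 0 U 0 U (p + q); rewrite /= !add0n => ->; congr (_ \o _).
Qed.

(** A new cup with adjacent legs absorbs the crossing.  Otherwise the diagram
    into which it was inserted is itself of the form [insert p q x], and
    [swap0_insert] and [cup_insert] lead to crossings away from the leftmost
    endpoint, applied to two insertions into [x]; those crossings are covered by
    [normal_swap_pos]. *)
Lemma normal_swap0 n y : swap_closed n -> normal n.+2 y ->
  normal n.+2 (slice 0 X n \o y).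
Proof.
move=> IHn /normalS_inv[[|k] [j [z [en nz ->]]]].
  rewrite add0n in en; subst j; rewrite insert0 ?(normal_type nz).2 //.
  rewrite bcompA -slice_comp relSU -insert0 ?(normal_type nz).2 //.
  exact: normal_insert.
have en' : n = (k + j).+1 by rewrite en addSn.
rewrite {2}en' swap0_insert; move: nz; case: n en en' IHn => [//|[|n]] en en' IHn nz.
  by case: (normal1_inv nz).
have [p [q [x [epq nx ez]]]] := normalS_inv nz; rewrite ez.
have -> : k + j = (p + q).+1 by lia.
rewrite cup_insert.
apply: (normal_past (n := n.+4) (lo := 1)) => //; last by lia.
  by move=> t [//|a] b _ nt eab; apply: normal_swap_pos => //; lia.
apply: normal_insert; last by lia.
rewrite -insert0; last by rewrite (normal_type nx).2.
by apply: normal_insert => //; lia.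
Qed.

Lemma normal_swap n : swap_closed n.
Proof.
elim/ltn_ind: n => -[|[|n]] IHn y a b ny eab; try lia.
case: a eab => [|a] eab; last by apply: normal_swap_pos => //; exact: IHn.
have -> : b = n by lia.
by apply: normal_swap0 => //; exact: IHn.
Qed.

Lemma bubble_normal n y : normal n y -> normal n ((A \o U) ** y).
Proof.
case=> M; elim=> {n y M} [b|i j y M nfy IHy]; first exact: (normal_bubbles b.+1).
suff -> : (A \o U) ** insert i j y = insert i j ((A \o U) ** y) by exact: normal_insert.
have bub x : (A \o U) ** x = slice 0 (A \o U) (bcod x) \o x.
  by rewrite btens_slicel bdom_comp slice00.
have [_ cy] := normal_type (ex_intro _ M nfy).
have ci : bcod (insert i j y) = (i + j).+2.
  by rewrite (normal_type (normal_insert (ex_intro _ M nfy) erefl)).2.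
rewrite !bub ci cy /insert.
have := slice_far 0 (A \o U) 1 (past i) j; rewrite bcod_past bdom_past bdom_comp bcod_comp.
rewrite /= add0n add1n addSn => e1.
have := slice_far 0 (A \o U) 0 U (i + j); rewrite bdom_comp bcod_comp /= !add0n => e2.
rewrite bcompA e1 -bcompA; congr (_ \o _).
by rewrite bcompA e2 -bcompA.
Qed.

Lemma normal_cap0 n y : normal n.+2 y -> normal n (slice 0 A n \o y).
Proof.
move=> /normalS_inv[[|k] [j [z [en nz ->]]]]; have [dz cz] := normal_type nz.
  rewrite add0n in en; subst j; rewrite insert0 // bcompA -slice_comp.
  have -> : slice 0 (A \o U) n \o z = (A \o U) ** z.
    by rewrite btens_slicel bdom_comp slice00 cz.
  exact: bubble_normal.
have en' : n = (k + j).+1 by rewrite en addSn.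
rewrite {2}en' cap0_insert -?en' //.
apply: (normal_past (n := n) (lo := 0)) => //.
by move=> t a b _; exact: normal_swap.
Qed.

(** Caps and cups are moved one place to the left at the cost of two crossings,
    so only those at the far left have to be studied. *)
Lemma slice_capS a b :
  slice a.+1 A b = slice a A b.+1 \o (slice a.+1 X b \o slice a X b.+1).
Proof.
have e : slice 1 A 0 = slice 0 A 1 \o (slice 1 X 0 \o slice 0 X 1).
  by rewrite bcompA rel_slideA -bcompA -slice_comp relSS slice_id bcomp_id.
have := congr1 (fun x => slice a x b) e.
by rewrite !slice_comp !slice_slice !add0n !addn0 !addn1 !add1n.
Qed.

Lemma slice_cupS a b :
  slice a.+1 U b = slice a X b.+1 \o (slice a.+1 X b \o slice a U b.+1).
Proof.
have := congr1 (fun x => slice a x b) (esym swap_cup).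
by rewrite !slice_comp !slice_slice !add0n !addn0 !addn1 !add1n.
Qed.

Lemma normal_cap n y a b : normal n.+2 y -> a + b = n ->
  normal n (slice a A b \o y).
Proof.
elim: a b y => [|a IHa] b y ny eab.
  by rewrite add0n in eab; rewrite eab; exact: normal_cap0.
rewrite slice_capS -!bcompA; apply: IHa; last lia.
by apply: normal_swap; [apply: normal_swap => //; lia | lia].
Qed.

Lemma normal_cup n y a b : normal n y -> a + b = n ->
  normal n.+2 (slice a U b \o y).
Proof.
elim: a b => [|a IHa] b ny eab.
  rewrite add0n in eab; rewrite -insert0 ?(normal_type ny).2 //.
  exact: normal_insert.
rewrite slice_cupS -!bcompA.
apply: normal_swap; last lia; apply: normal_swap; last lia.
by apply: IHa => //; lia.
Qed.

Lemma normal_diagram m s (d : diagram m s) a b y : normal (a + m + b) y ->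
  normal (a + s + b) (slice a (cls (diagram_term K d)) b \o y).
Proof.
elim: d a b y => {m s} /= [|||||m n s g IHg f IHf|m s m' s' f IHf g IHg] a b y ny.
- by rewrite slice_id bid_comp // (normal_type ny).2.
- by rewrite slice_id bid_comp // (normal_type ny).2.
- have -> : a + 2 + b = (a + 0 + b).+2 by lia.
  by apply: normal_cup => //; lia.
- by apply: normal_cap; [have <- : a + 2 + b = (a + 0 + b).+2 by lia | lia].
- exact: normal_swap.
- rewrite -cls_comp slice_comp -bcompA; exact/IHg/IHf.
rewrite -cls_tens btens_slicel slice_comp !slice_slice -bcompA /= !add0n !addn0.
have -> : a + (s + s') + b = a + s + (s' + b) by lia.
apply: IHf; have -> : a + m + (s' + b) = a + m + s' + b by lia.
by apply: IHg; have <- : a + (m + m') + b = a + m + m' + b by lia.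
Qed.

Lemma normal_closed_diagram n (d : diagram 0 n) :
  normal n (cls (diagram_term K d)).
Proof.
have := @normal_diagram 0 n d 0 0 (I 0) (normal_bubbles 0).
by rewrite addn0 slice00 bcomp_id.
Qed.

(** * Normal forms are determined by their matrices *)

(** The image of [x] in the free module on matrices is the basis vector [M]. *)
Definition has_matrix (x : bmor) (M : bmat) : Prop :=
  forall phi, ev (repr (bhom x)) phi = phi M.

Lemma ev_cls m s (f : term K m s) phi : ev (repr (bhom (cls f))) phi = ev f phi.
Proof. exact/ev_sound/repr_pi. Qed.

Lemma has_matrix_cls m s (f : term K m s) M :
  (forall phi, ev f phi = phi M) -> has_matrix (cls f) M.
Proof. by move=> h phi; rewrite ev_cls. Qed.

Lemma has_matrix_comp y x N M : bcod x = bdom y ->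
  has_matrix y N -> has_matrix x M -> has_matrix (y \o x) (bmat_comp (bcod x) N M).
Proof.
elim/clsP: x => m n f /=; elim/clsP: y => n' s g /= e; case: n' / e g => g hg hf.
rewrite cls_comp; apply: has_matrix_cls => phi /=.
by rewrite -[LHS]ev_cls hg -[LHS]ev_cls hf.
Qed.

Lemma has_matrix_tens x y M N : has_matrix x M -> has_matrix y N ->
  has_matrix (x ** y) (bmat_tens (bdom x) (bcod x) M N).
Proof.
elim/clsP: x => m s f; elim/clsP: y => m' s' g hf hg.
rewrite cls_tens; apply: has_matrix_cls => phi /=.
by rewrite -[LHS]ev_cls hf -[LHS]ev_cls hg.
Qed.

Lemma has_matrix_id n : has_matrix (I n) (bmat_id n).
Proof. by apply: has_matrix_cls. Qed.

Lemma has_matrix_slice a x b M : has_matrix x M ->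
  has_matrix (slice a x b) (bmat_slice a (bdom x) (bcod x) b M).
Proof.
move=> hx; exact: has_matrix_tens (has_matrix_tens (has_matrix_id a) hx) (has_matrix_id b).
Qed.

Lemma bcod_insert i j (y : bmor) : bcod (insert i j y) = (i + j).+2.
Proof. by rewrite bmor_ends /= bcod_past; lia. Qed.

Lemma has_matrix_insert i j y M : bcod y = i + j ->
  has_matrix y M -> has_matrix (insert i j y) (bmat_insert i j M).
Proof.
move=> cy hy; elim: i j cy => [|i IHi] j cy.
  rewrite insert0 // -[j in bmat_insert _ j _]/(0 + j) -cy.
  apply: has_matrix_comp => //.
  by rewrite cy; apply: (@has_matrix_slice 0 U j); apply: has_matrix_cls.
rewrite insertS /=; have -> : i.+1 + j.+2 = bcod (insert i j.+1 y).
  by rewrite bcod_insert; lia.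
apply: has_matrix_comp; first by rewrite bcod_insert /=; lia.
  by apply: (@has_matrix_slice i.+1 X j); apply: has_matrix_cls.
by apply: IHi; rewrite cy addSnnS.
Qed.

Lemma has_matrix_bubble_pow b : has_matrix (bubble_pow b) (bmat_bubbles b).
Proof.
elim: b => [|b IHb]; first exact: has_matrix_id.
have hAU : has_matrix (A \o U) (bmat_comp 2 bmat_A bmat_U).
  by apply: (@has_matrix_comp A U) => //; apply: has_matrix_cls.
have := has_matrix_tens hAU IHb; by rewrite bdom_comp bcod_comp.
Qed.

Lemma nf_has_matrix n (y : bmor) M : normal_form n y M -> has_matrix y M.
Proof.
elim=> {n y M} [b|i j y M nfy hy]; first exact: has_matrix_bubble_pow.
by apply: has_matrix_insert => //; case: (nf_type nfy).
Qed.

Lemma bmat_bubblesE b : bmat_bubbles b [::] [::] = 2 ^ b.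
Proof. by elim: b => //= b IHb; rewrite /bmat_tens /= IHb expnS. Qed.

Lemma nf_matrix_gt0 n (y : bmor) M :
  normal_form n y M -> 0 < M [::] (nseq n true).
Proof.
elim=> {n y M} [b|i j y M _ IHy]; first by rewrite bmat_bubblesE expn_gt0.
have -> : nseq (i + j).+2 true = true :: nseq i true ++ true :: nseq j true.
  by rewrite -addSn -addnS nseqD.
by rewrite bmat_insertE ?size_nseq // -nseqD eqxx muln1.
Qed.

(** The number of bubbles is read off from the entry of the empty diagram.  For
    an insertion, the partner of the leftmost endpoint is recognised as the only
    endpoint that must share its colour, and the matrix of the rest is a
    submatrix. *)
Lemma nf_inj n (y z : bmor) M N : normal_form n y M -> normal_form n z N ->
  (forall w, size w = n -> M [::] w = N [::] w) -> y = z.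
Proof.
move=> nfy; elim: nfy z N => {n y M} [b|i j y M nfy IHy] z N nfz eMN.
  move en : 0 nfz eMN => n nfz; case: nfz en => [b' _ /(_ [::] erefl)|//].
  by rewrite !bmat_bubblesE => /eqP; rewrite eqn_exp2l // => /eqP ->.
move en : (i + j).+2 nfz eMN => n nfz; case: nfz en => [//|i' j' {}z {}N nfz [en] eMN].
have eii' : i = i'.
  apply/eqP; apply/negPn/negP => nii'.
  (* The colouring with [false] at the leftmost endpoint and its partner for
     [i'], and [true] elsewhere, distinguishes [i'] from any other position. *)
  pose t := nseq i' true ++ false :: nseq j' true.
  have st : size t = (i' + j').+1 by rewrite size_cat /= !size_nseq; lia.
  have := eMN (false :: t); rewrite /= st => /(_ erefl).
  rewrite (@bmat_insertE i' j' N) ?size_nseq //.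
  have -> : t = take i t ++ nth false t i :: drop i.+1 t.
    by rewrite -drop_nth ?cat_take_drop // st; lia.
  rewrite (@bmat_insertE i j M); last by rewrite size_drop st; lia.
    have -> : nth false t i = true.
      rewrite /t nth_cat size_nseq; case: ltnP => ltii'; first by rewrite nth_nseq ltii'.
      have -> : i - i' = (i - i'.+1).+1 by lia.
      by rewrite /= nth_nseq ifT //; lia.
    rewrite muln0 -nseqD muln1 => /esym/eqP; rewrite eqn0Ngt.
    by rewrite (nf_matrix_gt0 nfz).
  by rewrite size_takel // st; lia.
subst i'; have ej : j = j' by lia.
subst j'; congr insert; apply: IHy nfz _ => w sw.
have := eMN (true :: take i w ++ true :: drop i w).
rewrite !bmat_insertE ?size_takel ?size_drop ?sw ?leq_addr ?addKn // cat_take_drop !muln1.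
by apply; rewrite /= size_cat /= size_takel ?size_drop sw; lia.
Qed.

(** * Equivalent diagrams represent the same morphism *)

Fixpoint diagram_id m : diagram m m :=
  if m is m'.+1 then dTens dStrand (diagram_id m') else dEmpty.

(** The leftmost bottom endpoint becomes the leftmost top endpoint. *)
Definition bend m s (d : diagram m.+1 s) : diagram m (1 + s) :=
  dComp (dTens dStrand d) (dTens dU (diagram_id m)).

Definition dcls m s (d : diagram m s) : bmor := cls (diagram_term K d).

Lemma dcls_id m : dcls (diagram_id m) = I m.
Proof.
elim: m => // m IHm.
transitivity (btens (I 1) (dcls (diagram_id m))); first by rewrite /dcls cls_tens.
rewrite IHm; exact: (btens_id 1 m).
Qed.

Lemma dcls_bend m s (d : diagram m.+1 s) :
  dcls (bend d) = slice 1 (dcls d) 0 \o slice 0 U m.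
Proof.
have -> : dcls (bend d) =
    btens (I 1) (dcls d) \o btens U (dcls (diagram_id m)).
  by rewrite /dcls !cls_tens; symmetry; apply: cls_comp.
rewrite dcls_id.
by rewrite /slice bid0_tens btens_id0.
Qed.

(** A zigzag straightens the bent strand. *)
Lemma unbend m s (d : diagram m.+1 s) :
  slice 0 A s \o slice 1 (dcls (bend d)) 0 = dcls d.
Proof.
rewrite dcls_bend slice_comp !slice_slice bcompA.
have := slice_far 0 A 0 (dcls d) 0; rewrite /= !add0n !addn0 => ->; rewrite slice00 -bcompA.
rewrite (_ : slice 0 A m.+1 = slice 0 (slice 0 A 1) m); last by rewrite slice_slice.
rewrite (_ : slice 1 _ m = slice 0 (slice 1 U 0) m); last by rewrite slice_slice.
by rewrite -slice_comp rel_zigzagr slice_id bcomp_id.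
Qed.

Lemma eq_on_functions (T : Type) (x y : T) : (1 : K)%R <> 0%R ->
  (forall phi : T -> K, phi x = phi y) -> x = y.
Proof.
move=> nz /(_ (fun z => if `[< z = x >] then 1%R else 0%R)).
by rewrite asboolT //; case: asboolP => // ->.
Qed.

(** Bending brings all bottom endpoints to the top and changes equal matrices
    into equal matrices.  Then both diagrams have normal forms, whose matrices
    agree with those of the diagrams: a basis vector of a free module determines
    the matrix as long as [K] is not the zero ring. *)
Lemma dcls_of_dmat m s (d d' : diagram m s) : (1 : K)%R <> 0%R ->
  dmat d = dmat d' -> dcls d = dcls d'.
Proof.
move=> nz; elim: m s d d' => [|m IHm] s d d' edd'.
  have [M nfd] := normal_closed_diagram d.
  have [M' nfd'] := normal_closed_diagram d'.
  have mat (e : diagram 0 s) N : normal_form s (dcls e) N -> dmat e = N.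
    move=> nfe; apply: (eq_on_functions nz) => phi.
    by rewrite -(nf_has_matrix nfe) /dcls ev_cls ev_diagram.
  by apply: (nf_inj nfd nfd') => w _; rewrite -(mat _ _ nfd) -(mat _ _ nfd') edd'.
rewrite -[LHS]unbend -[RHS]unbend (IHm _ (bend d) (bend d')) //=.
by rewrite edd'.
Qed.

Lemma diagram_hom_equiv m s (d d' : diagram m s) :
  diagram_equiv d d' -> diagram_hom K d = diagram_hom K d'.
Proof.
move=> /diagram_equiv_dmat edd'; apply/pi_homP.
(* Over the zero ring all morphisms are zero. *)
have [K1|nz] := pselect ((1 : K)%R = 0%R); last exact/cls_inj/dcls_of_dmat.
have zero (f : term K m s) : term_eq f (tZero m s).
  by apply: te_trans (te_scale0 f); rewrite -K1; exact/te_sym/te_scale1.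
exact: te_trans (zero _) (te_sym (zero _)).
Qed.

End Morphisms.

(** * Diagrams span *)

Section Spanning.
Variable K : comPzRingType.
Local Open Scope ring_scope.

Inductive spanned m s : term K m s -> Prop :=
| spanned_diagram d : spanned (diagram_term K d)
| spanned_zero : spanned (tZero m s)
| spanned_add f g : spanned f -> spanned g -> spanned (tAdd f g)
| spanned_scale a f : spanned f -> spanned (tScale a f)
| spanned_eq f g : term_eq g f -> spanned f -> spanned g.

Lemma spanned_comp m n s (g : term K n s) (f : term K m n) :
  spanned g -> spanned f -> spanned (tComp g f).
Proof.
move=> sg sf; elim: sg => {g} [d||g g' _ IHg _ IHg'|a g _ IHg|g g' gg' _ IHg].
- elim: sf => {f} [d'||f f' _ IHf _ IHf'|a f _ IHf|f f' ff' _ IHf].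
  + exact: (spanned_diagram (dComp d d')).
  + exact: spanned_eq (te_comp_zero _ _) (spanned_zero _ _).
  + exact: spanned_eq (te_compDr _ _ _) (spanned_add IHf IHf').
  + exact: spanned_eq (te_compZr _ _ _) (spanned_scale _ IHf).
  + exact: spanned_eq (te_comp (te_refl _) ff') IHf.
- exact: spanned_eq (te_zero_comp _ _) (spanned_zero _ _).
- exact: spanned_eq (te_compDl _ _ _) (spanned_add IHg IHg').
- exact: spanned_eq (te_compZl _ _ _) (spanned_scale _ IHg).
- exact: spanned_eq (te_comp gg' (te_refl _)) IHg.
Qed.

Lemma spanned_tens m s m' s' (f : term K m s) (g : term K m' s') :
  spanned f -> spanned g -> spanned (tTens f g).
Proof.
move=> sf sg; elim: sf => {f} [d||f f' _ IHf _ IHf'|a f _ IHf|f f' ff' _ IHf].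
- elim: sg => {g} [d'||g g' _ IHg _ IHg'|a g _ IHg|g g' gg' _ IHg].
  + exact: (spanned_diagram (dTens d d')).
  + exact: spanned_eq (te_tens_zero _ _ _) (spanned_zero _ _).
  + exact: spanned_eq (te_tensDr _ _ _) (spanned_add IHg IHg').
  + exact: spanned_eq (te_tensZr _ _ _) (spanned_scale _ IHg).
  + exact: spanned_eq (te_tens (te_refl _) gg') IHg.
- exact: spanned_eq (te_zero_tens _ _ _) (spanned_zero _ _).
- exact: spanned_eq (te_tensDl _ _ _) (spanned_add IHf IHf').
- exact: spanned_eq (te_tensZl _ _ _) (spanned_scale _ IHf).
- exact: spanned_eq (te_tens ff' (te_refl _)) IHf.
Qed.

Lemma te_id_diagram m : term_eq (diagram_term K (diagram_id m)) (tId m).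
Proof. exact/cls_inj/dcls_id. Qed.

Lemma te_opp_scale m s (f : term K m s) : term_eq (tOpp f) (tScale (-1) f).
Proof.
by apply/pi_homP; rewrite -hom_oppE -hom_scaleE; exact/esym/scaleN1r.
Qed.

Lemma all_spanned m s (f : term K m s) : spanned f.
Proof.
elim: f => {m s} [m|m n s g sg f sf|m s m' s' f sf g sg||||m s|m s f sf|m s f sf g sg
  |m s a f sf].
- exact: spanned_eq (te_sym (te_id_diagram m)) (spanned_diagram _).
- exact: spanned_comp.
- exact: spanned_tens.
- exact: (spanned_diagram dU).
- exact: (spanned_diagram dA).
- exact: (spanned_diagram dS).
- exact: spanned_zero.
- exact: spanned_eq (te_opp_scale f) (spanned_scale _ sf).
- exact: spanned_add.
- exact: spanned_scale.
Qed.

Lemma spanned_sum m s (f : term K m s) : spanned f ->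
  exists l : seq (K * diagram m s),
    \pi_(brauer_hom K m s)%qT f = \sum_(p <- l) p.1 *: diagram_hom K p.2.
Proof.
elim=> {f} [d||f g _ [l lE] _ [l' lE']|a f _ [l lE]|f g gf _ [l lE]].
- by exists [:: (1, d)]; rewrite big_seq1 scale1r.
- by exists [::]; rewrite big_nil.
- by exists (l ++ l'); rewrite big_cat /= -lE -lE' -hom_addE.
- exists [seq (a * p.1, p.2) | p <- l]; rewrite big_map -hom_scaleE lE.
  transitivity (a *: (\sum_(p <- l) p.1 *: diagram_hom K p.2)) => //.
  by rewrite scaler_sumr; apply: eq_bigr => p _ /=; rewrite scalerA.
- by exists l; rewrite -lE; apply/pi_homP.
Qed.

End Spanning.

(** * Linear independence and the basis theorem *)

(** Collects the terms with the same index, so that the coefficient becomes a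
    function of the index. *)
Lemma sum_group (K : pzRingType) (V : lmodType K) (T I : eqType)
    (l : seq (K * T)) (g : T -> I) (b : I -> V) :
  (\sum_(p <- l) p.1 *: b (g p.2) =
   \sum_(i <- undup [seq g p.2 | p <- l]) (\sum_(p <- l | g p.2 == i) p.1) *: b i)%R.
Proof.
under [RHS]eq_bigr => i _ do rewrite scaler_suml.
rewrite (exchange_big_dep predT) //= big_seq [RHS]big_seq.
apply: eq_bigr => p pl; rewrite -big_filter.
rewrite (_ : [seq i <- _ | _] = [:: g p.2]) ?big_seq1 //.
rewrite (eq_filter (a2 := pred1 (g p.2))); last by move=> i /=; rewrite eq_sym.
by rewrite filter_pred1_uniq ?undup_uniq // mem_undup; apply/mapP; exists p.
Qed.

Section Independence.
Variables (K : comPzRingType) (m s : nat).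
Local Open Scope ring_scope.

Definition hom_ev (x : brauer_hom K m s) (phi : bmat -> K) : K := ev (repr x) phi.

Lemma hom_evE f phi : hom_ev (\pi_(brauer_hom K m s)%qT f) phi = ev f phi.
Proof. exact/ev_sound/repr_pi. Qed.

Lemma hom_ev_sum (I : Type) (r : seq I) (c : I -> K) (d : I -> diagram m s) phi :
  hom_ev (\sum_(i <- r) c i *: diagram_hom K (d i)) phi =
  \sum_(i <- r) c i * phi (dmat (d i)).
Proof.
elim: r => [|i r IHr]; first by rewrite !big_nil hom_evE.
rewrite !big_cons -IHr; elim/quotW: (\sum_(j <- r) _) => f.
rewrite [X in hom_ev (X + _)]hom_scaleE [X in hom_ev X]hom_addE !hom_evE /=.
by rewrite ev_diagram.
Qed.

End Independence.

Theorem theoremA (K : comPzRingType)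
    (two_invertible : exists h : K, (2%:R * h = 1)%R) (m s : nat) :
  exists b : diagram_class m s -> brauer_hom K m s,
    (forall d : diagram m s, b (\pi_(diagram_class m s)%qT d) = diagram_hom K d)
    /\ is_basis b.
Proof.
pose b (c : diagram_class m s) := diagram_hom K (repr c).
have bE d : b (\pi_(diagram_class m s)%qT d) = diagram_hom K d.
  by apply: diagram_hom_equiv; apply/eqmodP; rewrite reprK.
exists b; split; first exact: bE.
split=> [r c r_uniq sum0 i ir|v].
  (* Evaluation at the indicator of the matrix of [i] extracts its coefficient. *)
  pose phi (M : bmat) : K := if `[< M = dmat (repr i) >] then 1%R else 0%R.
  have := hom_ev_sum r c (fun j => repr j) phi; rewrite [X in hom_ev X _]sum0.
  rewrite hom_evE /= (bigD1_seq i) //= {1}/phi asboolT // mulr1 big1 ?addr0 // => j nji.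
  rewrite /phi; case: asboolP => [|_]; last by rewrite mulr0.
  move=> /diagram_equiv_dmat eji; case/eqP: nji.
  by rewrite -[j]reprK -[i]reprK; apply/eqmodP.
elim/quotW: v => f; have [l ->] := spanned_sum (all_spanned f).
under eq_bigr do rewrite -bE.
by rewrite sum_group; eexists; eexists.
Qed.
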